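(* Let $d\ge2$ be an integer, put $k=d+1$, and let $\boldsymbol\omega\in\mathcal G_{k,3}$. Then the following two statements are equivalent. (i) (Littlewood's conjecture in $d$ dimensions.) For every $\boldsymbol\alpha=(\alpha_1,\ldots,\alpha_d)\in\mathbb R^d$, $$\liminf_{n\to\infty}\,n\,\|n\alpha_1\|\cdots\|n\alpha_d\|=0.$$ (ii) Every $d$-dimensional Kronecker sequence has unbounded $C^3$-smooth discrepancy, that is, for every $\boldsymbol\alpha\in\mathbb R^d$, $$\sup_{N\in\mathbb N}D_{\boldsymbol\omega}(\boldsymbol\alpha;N)=\infty.$$
   Context: Notation. $\|x\|=\min_{a\in\mathbb Z}|x-a|$ for $x\in\mathbb R$. $e(z)=e^{2\pi i z}$ and $\widehat f(\xi)=\int_{\mathbb R}f(x)e(-\xi x)\,dx$. The Kronecker sequence of $\boldsymbol\alpha\in\mathbb R^d$ is $(n\boldsymbol\alpha \bmod 1)_{n\ge1}$. The class $\mathcal G_{k,\ell}$ (here with $\ell=3$). It is the set of $\boldsymbol\omega=(\omega_1,\ldots,\omega_k)$ such that for each $i\le k$: $\omega_i:\mathbb R\to[0,\infty)$ is $\ell$ times continuously differentiable, $\mathrm{supp}(\omega_i)\subseteq[-2,2]$, $\widehat\omega_i\ge0$ everywhere, and $\widehat\omega_i(0)>0$. Smooth discrepancy. Put $\mathfrak C(\boldsymbol\omega)=\widehat\omega_1(0)\cdots\widehat\omega_k(0)$. A box is a pair $\mathfrak B=(\boldsymbol\gamma;\boldsymbol\rho)$ with $\boldsymbol\gamma\in\mathbb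 R^d$, $\boldsymbol\rho\in(0,1/2)^d$, and $\mathrm{vol}(\mathfrak B;N)=\rho_1\cdots\rho_dN$. Define $$D_{\boldsymbol\omega}(\mathfrak B;N)=\sum_{\mathbf a\in\mathbb Z^k}\omega_k\Big(\frac{a_k}{N}\Big)\prod_{i\le d}\omega_i\Big(\frac{a_i+a_k\alpha_i-\gamma_i}{\rho_i}\Big)-\mathfrak C(\boldsymbol\omega)\,\mathrm{vol}(\mathfrak B;N)$$ and the $C^\ell$-smooth discrepancy $D_{\boldsymbol\omega}(\boldsymbol\alpha;N)=\sup_{\mathfrak B}|D_{\boldsymbol\omega}(\mathfrak B;N)|$, the supremum being over all boxes $\mathfrak B=(\boldsymbol\gamma;\boldsymbol\rho)$ with $\boldsymbol\gamma\in\mathbb R^d$ and $\boldsymbol\rho\in(0,1/2)^d$. *)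

(* Defs.v *)
From HB Require Import structures.
From mathcomp Require Import all_boot all_order all_algebra.
From mathcomp Require Import complex.
From mathcomp Require Import all_classical all_reals all_analysis.

Set Implicit Arguments.
Unset Strict Implicit.
Unset Printing Implicit Defensive.

Import Order.TTheory GRing.Theory Num.Theory.
Import numFieldNormedType.Exports.

Local Open Scope classical_set_scope.
Local Open Scope ring_scope.
Local Open Scope complex_scope.

Definition dist_int (R : realType) (x : R) : R :=
  inf [set `|x - a%:~R| | a in [set: int]].

Definition cexp_2pi (R : realType) (x : R) : R[i] :=
  cos (2 * pi * x) +i* sin (2 * pi * x).

Definition fourier (R : realType) (f : R -> R) (xi : R) : R[i] :=
  (\int[lebesgue_measure]_x complex.Re ((f x)%:C * cexp_2pi (- xi * x)))
  +i* (\int[lebesgue_measure]_x complex.Im ((f x)%:C * cexp_2pi (- xi * x))).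

Definition times_cont_diff (R : realType) (l : nat) (f : R -> R) : Prop :=
  (forall m : nat, (m < l)%N -> forall x : R, derivable (derive1n m f) x 1) /\
  continuous (derive1n l f).

Definition supp (R : realType) (f : R -> R) : set R :=
  closure [set x | f x != 0].

(* The order on [R[i]] is the partial order for which [0 <= z] means that [z]
   is real and nonnegative, and [0 < z] that it is moreover nonzero. *)
Definition weight_class (R : realType) (k l : nat) : set ('I_k -> R -> R) :=
  [set omega | forall i : 'I_k,
     [/\ forall x : R, 0 <= omega i x,
         times_cont_diff l (omega i),
         supp (omega i) `<=` `[- 2, 2],
         forall xi : R, 0 <= fourier (omega i) xi
       & 0 < fourier (omega i) 0]].

(* A box is the pair (gamma; rho) of its center and its radii. *)
Definition boxes (R : realType) (d : nat) : set ('rV[R]_d * 'rV[R]_d) :=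
  [set B : 'rV[R]_d * 'rV[R]_d | forall i : 'I_d, 0 < B.2 0 i < 2^-1].

Arguments boxes : clear implicits.

Definition box_vol (R : realType) (d : nat) (B : 'rV[R]_d * 'rV[R]_d)
    (N : nat) : R :=
  (\prod_(i < d) B.2 0 i) * N%:R.

(* The Fourier coefficients at 0 are real for weights in [weight_class]. *)
Definition weight_const (R : realType) (k : nat) (omega : 'I_k -> R -> R) : R :=
  \prod_(i < k) complex.Re (fourier (omega i) 0).

(* With k = d + 1, the last index k is [ord_max : 'I_d.+1] and the i-th of the
   first d indices is [widen_ord (leqnSn d) i].  The summand is nonnegative and,
   for N > 0, has finite support for weights in [weight_class]. *)
Definition box_count (R : realType) (d : nat) (omega : 'I_d.+1 -> R -> R)
    (alpha : 'rV[R]_d) (B : 'rV[R]_d * 'rV[R]_d) (N : nat) : \bar R :=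
  \esum_(a in [set: 'rV[int]_d.+1])
    (omega ord_max ((a 0 ord_max)%:~R / N%:R) *
     \prod_(i < d) omega (widen_ord (leqnSn d) i)
       (((a 0 (widen_ord (leqnSn d) i))%:~R + (a 0 ord_max)%:~R * alpha 0 i
          - B.1 0 i) / B.2 0 i))%:E.

Definition box_discrepancy (R : realType) (d : nat)
    (omega : 'I_d.+1 -> R -> R) (alpha : 'rV[R]_d)
    (B : 'rV[R]_d * 'rV[R]_d) (N : nat) : \bar R :=
  (box_count omega alpha B N - (weight_const omega * box_vol B N)%:E)%E.

Definition smooth_discrepancy (R : realType) (d : nat)
    (omega : 'I_d.+1 -> R -> R) (alpha : 'rV[R]_d) (N : nat) : \bar R :=
  ereal_sup [set `|box_discrepancy omega alpha B N|%E | B in boxes R d].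

Definition littlewood (R : realType) (d : nat) : Prop :=
  forall alpha : 'rV[R]_d,
    limn_einf (fun n : nat =>
      (n%:R * \prod_(i < d) dist_int (n%:R * alpha 0 i))%:E) = 0%E.

(* N ranges over positive integers: N divides in [box_count]. *)
Definition unbounded_smooth_discrepancy (R : realType) (d : nat)
    (omega : 'I_d.+1 -> R -> R) : Prop :=
  forall alpha : 'rV[R]_d,
    ereal_sup [set smooth_discrepancy omega alpha N
              | N in [set N : nat | (0 < N)%N]] = +oo%E.

(* Main.v *)
Require Import Defs.
From HB Require Import structures.
From mathcomp Require Import all_boot all_order all_algebra.
From mathcomp Require Import ring lra zify.
From mathcomp Require Import complex.
From mathcomp Require Import all_classical all_reals all_analysis.

Set Implicit Arguments.
Unset Strict Implicit.
Unset Printing Implicit Defensive.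

Import Order.TTheory GRing.Theory Num.Theory.
Import numFieldNormedType.Exports.
Import Normc.

Local Open Scope ring_scope.

(** Write [||x||] for the distance from [x] to the nearest integer, and call
    [alpha] badly approximable when [n ||n alpha_1|| ... ||n alpha_d|| >= c] for
    some [c > 0] and all [n >= 1].  Passing from [n] to a fixed multiple of [n]
    changes the product by a bounded factor, so a positive liminf already makes
    [alpha] badly approximable ([not_littlewood_simul_bad]).  The equivalence
    holds for each [alpha] separately: its smooth discrepancy is bounded exactly
    when it is badly approximable.

    Suppose that [n ||n alpha_1|| ... ||n alpha_d||] is tiny.  The points
    [j n alpha] with [j < J] move slowly modulo one: a box with radii about
    [J ||n alpha_i||] and a window [N] of length about [n J] have volume at most
    a constant times [J^(d + 1) n ||n alpha_1|| ... ||n alpha_d||], which is at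
    most [1] if [n] is chosen after [J].  Where a radius has to be cut down to
    stay below [1/2], the pigeonhole principle still puts a positive proportion
    of the [J] points in one cell, and since the centre of the box is free it can be placed on that cell.
    The count is then at least a constant times [J] against a bounded volume,
    and [J] is arbitrary ([clustered_box], [littlewood_implies_unbounded]).

    Conversely let [alpha] be badly approximable.  Expanding the [d] periodic
    factors of the count in Fourier series turns it into a sum over frequencies
    [b] in [Z^d].  The zero frequency is the volume term, up to the bounded
    error of a Riemann sum.  With [C^2] weights, a frequency [b <> 0]
    contributes at most a constant times [N rho_1 ... rho_d] times the product
    of the decay factors [min(1, (rho_i b_i)^-2)] and [min(1, (N ||b.alpha||)^-2)]
    ([coef_bound], [expsum_bound]).  Two facts make the sum of these bounded.
    By transference ([simul_bad_dual_bad]) the form [b.alpha] is bounded below: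
    [||b.alpha|| (max(1, |b_1|) ... max(1, |b_d|)) >= c'].  Consequently the
    values [b.alpha] modulo one are well separated as [b] runs through a box,
    and a box with sides [X_i] contains at most a constant times
    [Y X_1 ... X_d] vectors [b <> 0] with [||b.alpha|| <= Y]
    ([card_dual_box]).  There is no additive constant in this bound, because
    the zero vector takes up one of the separated slots.  Summing over dyadic
    boxes, the sum of the decay factors is at most a constant divided by
    [N rho_1 ... rho_d] ([dual_sum_bound]): the volume cancels whatever its
    size, and the bound is uniform in [N] and in the box
    ([periodic_count_bound]).

    Fourier series enter through trigonometric interpolation.  The
    interpolating polynomial with [2 m + 1] equidistant nodes has finitely many
    frequencies, its coefficients are exponential sums of the same kind as the
    one coming from the window [N], and they satisfy the decay bounds uniformly
    in [m]; it is therefore enough to know that it converges pointwise as [m]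
    grows ([interp_tends]). *)

(** * Pigeonhole principles *)

Lemma le_of_eq (R : numDomainType) (x y : R) : x = y -> x <= y.
Proof. by move->. Qed.

Lemma fiber_pigeonhole (T U : finType) (f : T -> U) (r : nat) :
  (r * #|U| < #|T|)%N -> exists u, (r < #|[set x | f x == u]|)%N.
Proof.
move=> ltrT; apply/existsP; apply: contraTT ltrT; rewrite negb_exists => /forallP small.
rewrite -leqNgt -sum1_card (partition_big f predT) //= mulnC -sum_nat_const.
by apply: leq_sum => u _; rewrite sum1dep_card leqNgt small.
Qed.

Lemma truncn_eq_dist (R : realType) (x y : R) :
  0 <= x -> 0 <= y -> Num.truncn x = Num.truncn y -> `|x - y| < 1.
Proof.
move=> /truncn_itv xI /truncn_itv yI exy; move: xI yI; rewrite exy.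
set t := Num.truncn y; rewrite -(natr1 t) ltr_norml => /andP[? ?] /andP[? ?].
by apply/andP; split; lra.
Qed.

(** Slices of width [1 / K i] in each direction [i] cut the unit cube into
    [\prod_i K i] cells, so some cell holds more than [r] of the points. *)
Lemma cell_pigeonhole (R : realType) (T I : finType) (x : T -> I -> R)
    (K : I -> nat) (r : nat) :
  (forall i, 0 < K i)%N -> (forall t i, 0 <= x t i < 1) ->
  (r * \prod_i K i < #|T|)%N ->
  exists A : {set T}, (r < #|A|)%N /\
    {in A &, forall s t i, `|x s i - x t i| < (K i)%:R^-1}.
Proof.
move=> K0 x01 ltrT.
have cellP t i : (Num.truncn ((K i)%:R * x t i) < K i)%N.
  have /andP[x0 x1] := x01 t i.
  rewrite truncn_lt_nat ?mulr_ge0 //.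
  by rewrite -[ltRHS]mulr1 ltr_pM2l // ltr0n.
pose cell t : {dffun forall i, 'I_(K i)} := [ffun i => Ordinal (cellP t i)].
have cardU : #|{dffun forall i, 'I_(K i)}| = (\prod_i K i)%N.
  rewrite card_dep_ffun foldrE big_map big_enum /=.
  by apply: eq_bigr => i _; rewrite card_ord.
have [u ru] : exists u, (r < #|[set t | cell t == u]|)%N.
  by apply: fiber_pigeonhole; rewrite cardU.
exists [set t | cell t == u]; split => // s t; rewrite !inE => /eqP su /eqP tu i.
have KR0 : 0 < (K i)%:R :> R by rewrite ltr0n.
have : cell s i = cell t i by rewrite su tu.
rewrite !ffunE => -[] /truncn_eq_dist; case/andP: (x01 s i) => s0 _.
case/andP: (x01 t i) => t0 _ /(_ (mulr_ge0 (ltW KR0) s0) (mulr_ge0 (ltW KR0) t0)).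
by rewrite -mulrBr normrM gtr0_norm // mulrC -ltr_pdivlMr // div1r.
Qed.

(** * Transference to linear forms *)

(** Quantifying over all integers [a i] in place of taking the nearest ones
    keeps the condition free of infima. *)
Definition simul_bad (R : realType) (d : nat) (c : R) (al : 'I_d -> R) :=
  forall n : nat, (0 < n)%N -> forall a : 'I_d -> int,
    c <= n%:R * \prod_i `|n%:R * al i - (a i)%:~R|.

Definition height (z : int) : nat := maxn 1 `|z|.

Definition dual_bad (R : realType) (d : nat) (c : R) (al : 'I_d -> R) :=
  forall (b : 'I_d -> int) (b0 : int), (exists i, b i != 0) ->
    c <= `|\sum_i (b i)%:~R * al i - b0%:~R| * \prod_i (height (b i))%:R.

Lemma height_gt0 z : (0 < height z)%N. Proof. by rewrite leq_max. Qed.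

Lemma normr_height (R : realType) z : `|z%:~R| <= (height z)%:R :> R.
Proof. by rewrite -intr_norm -abszE -[(_)%:~R]/(_%:R) ler_nat leq_maxr. Qed.

Definition frac (R : realType) (x : R) : R := x - (Num.floor x)%:~R.

Lemma frac_itv (R : realType) (x : R) : 0 <= frac x < 1.
Proof.
have /andP[] := floor_itv x; rewrite /frac intrD => ? ?.
by rewrite subr_ge0; apply/andP; split => //; rewrite ltrBlDl.
Qed.

Lemma int_lt1_eq0 (R : realType) (z : int) : `|z%:~R : R| < 1 -> z = 0.
Proof.
move=> z1; apply/eqP; apply: contraTT z1 => z0; rewrite -leNgt.
by apply: norm_intr_ge1; rewrite ?intr_int // intr_eq0.
Qed.

(** Transference.  Let [delta = b.alpha - b0] and [X i = height (b i)].  Among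
    [T] consecutive multiples of [alpha], two fall in the same cell of a
    partition of the torus whose sides are proportional to [1 / X i].  Their
    difference [h alpha] is congruent to a small vector [r], and [h delta] and
    [b.r] are at most [1/2], the former strictly less; as they differ by an
    integer they are equal.  This relation determines the coordinate [r i0] from
    the others, so that direction [i0] need not be cut any further, while all the other
    directions and the multiple are cut [m] times finer.  The gain of one
    factor [m] gives a product [h |r_1| ... |r_d|] of order [1 / m], which
    contradicts bad approximability once [m] is a large constant. *)
Lemma simul_bad_dual_bad (R : realType) (d : nat) (c : R) (al : 'I_d -> R) :
  0 < c -> simul_bad c al ->
  exists2 c' : R, 0 < c' & dual_bad c' al.
Proof.
move=> c0 bad.
pose D : nat := ((2 * d) ^ d)%N.
pose m := (Num.truncn (2 * D%:R / c)).+1.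
have m0 : (0 : R) < m%:R by rewrite ltr0n.
have mP : 2 * D%:R / c < m%:R by exact: truncnS_gt.
have D0 (i : 'I_d) : (0 < D)%N.
  by rewrite expn_gt0 muln_gt0 (leq_ltn_trans _ (ltn_ord i)).
exists (4 * (m ^ d * D)%N.+1%:R)^-1; first by rewrite invr_gt0 mulr_gt0 ?ltr0n.
move=> b b0 [i0 bi0]; rewrite leNgt; apply/negP => small.
pose delta := \sum_i (b i)%:~R * al i - b0%:~R.
pose X i := height (b i).
pose T := (m ^ d * D * \prod_i X i).+1.
have dpos : (0 < d)%N by apply: leq_ltn_trans (ltn_ord i0).
have X0 i : (0 < X i)%N by exact: height_gt0.
have XR0 i : (0 : R) < (X i)%:R by rewrite ltr0n.
have Dpos := D0 i0.
have cardD1 : #|(fun i => i != i0)| = d.-1.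
  by rewrite -[in RHS](card_ord d) -(cardC1 i0).
have PX0 : (0 < \prod_i X i)%N by rewrite prodn_gt0.
have T2 : T%:R <= 2 * (m ^ d * D * \prod_i X i)%N%:R :> R.
  rewrite -natrM ler_nat mul2n -addnn /T -addn1 leq_add2l.
  by rewrite !muln_gt0 expn_gt0 /= Dpos PX0.
have Tdelta : T%:R * `|delta| < 2^-1.
  apply: le_lt_trans (ler_wpM2r (normr_ge0 _) T2) _.
  rewrite natrM natr_prod -!mulrA [_ * `|delta|]mulrC.
  have E0 : 0 < 4 * (m ^ d * D)%N.+1%:R :> R by rewrite mulr_gt0 ?ltr0n.
  move: small; rewrite -[ltRHS]div1r ltr_pdivlMr // -/delta -/X => small.
  have : (m ^ d * D)%N%:R <= (m ^ d * D)%N.+1%:R :> R by rewrite ler_nat.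
  have : 0 <= `|delta| * (\prod_i (X i)%:R) by rewrite mulr_ge0 // prodr_ge0.
  move=> u0 MM; have := ler_wpM2r u0 MM; move: small.
  by clear; set u := `|_| * _; move: (u) => v; lra.
(* The coordinate [None] records the multiple, [Some i] the position on the
   torus; only the direction [i0] is spared the factor [m]. *)
pose K (o : option 'I_d) : nat :=
  if o is Some i then (2 * d * X i * (if i == i0 then 1 else m))%N else m.
pose x (n : 'I_T) (o : option 'I_d) : R :=
  if o is Some i then frac (n%:R * al i) else n%:R / T%:R.
have [] := @cell_pigeonhole R 'I_T (option 'I_d) x K 1.
- by case=> //= i; rewrite !muln_gt0 dpos X0 /=; case: eqP.
- move=> n [i|] /=; first exact: frac_itv.
  by rewrite divr_ge0 //= ltr_pdivrMr ?ltr0n // mul1r ltr_nat.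
- rewrite mul1n card_ord (bigD1 None) //= (reindex_omap Some id) /=; last by case.
  rewrite (eq_bigl predT) => [|i]; last exact: eqxx.
  rewrite big_split big_split /= prod_nat_const card_ord -/D.
  rewrite [X in (m * (_ * X))%N](bigD1 i0) //= eqxx mul1n [X in (m * (_ * X))%N](eq_bigr (fun=> m)) => [|i /negPf -> //].
  rewrite prod_nat_const cardD1 mulnCA -expnS prednK //.
  by rewrite mulnC mulnA /T.
move=> A [/card_gt1P[s [t [sA tA st]]] Aclose].
wlog lt_st : s t sA tA st / (s < t)%N.
  move: st; rewrite neq_ltn => /orP[] lst H; first by apply: (H s t) => //; rewrite neq_ltn lst.
  by apply: (H t s) => //; rewrite neq_ltn lst.
pose h := (t - s)%N.
have h0 : (0 < h)%N by rewrite subn_gt0.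
have hE : h%:R = t%:R - s%:R :> R by rewrite natrB // ltnW.
have hT : h%:R < T%:R / m%:R :> R.
  have := Aclose t s tA sA None; rewrite /= -mulrBl -hE ger0_norm ?divr_ge0 //.
  by rewrite ltr_pdivrMr ?ltr0n // mulrC.
pose a i := Num.floor (t%:R * al i) - Num.floor (s%:R * al i).
pose r i := h%:R * al i - (a i)%:~R.
have rK i : `|r i| < (K (Some i))%:R^-1.
  have := Aclose t s tA sA (Some i); congr (`|_| < _).
  by rewrite /= /frac /r hE /a intrB; ring.
(* Both sides of the relation are at most one half, one of them strictly. *)
have hd : `|h%:R * delta| < (2 * m%:R)^-1.
  rewrite normrM normr_nat invfM ltr_pdivlMr // mulrAC.
  apply: le_lt_trans Tdelta; apply: ler_wpM2r => //.
  by rewrite -ler_pdivlMr // ltW.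
have bK i : `|(b i)%:~R * r i| <= (2 * d * (if i == i0 then 1 else m))%N%:R^-1.
  rewrite normrM -[leRHS](mulVKf (lt0r_neq0 (XR0 i))).
  rewrite ler_pM ?normr_height //.
  by apply: ltW; apply: lt_le_trans (rK i) _; rewrite -invfM -natrM /K mulnCA mulnA.
have relE : h%:R * delta = \sum_i (b i)%:~R * r i.
  pose z : int := \sum_i b i * a i - h%:Z * b0.
  have zE : h%:R * delta = \sum_i (b i)%:~R * r i + z%:~R.
    rewrite /delta /z /r intrB mulrBr mulr_sumr intrM addrA.
    congr (_ - _).
    rewrite (raddf_sum (intmul 1)) -big_split /=; apply: eq_bigr => i _.
    by rewrite rmorphM /=; ring.
  suff z0 : z = 0 by rewrite zE z0 addr0.
  apply: (@int_lt1_eq0 R).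
  have -> : z%:~R = h%:R * delta - \sum_i (b i)%:~R * r i by rewrite zE; ring.
  apply: le_lt_trans (ler_normB _ _) _.
  have m1 : (2 * m%:R)^-1 <= 2^-1 :> R.
    by rewrite lef_pV2 ?posrE ?mulr_gt0 // ler_peMr // ler1n.
  suff : `|\sum_i (b i)%:~R * r i| <= 2^-1 by move: m1 hd; clear; lra.
  apply: le_trans (ler_norm_sum _ _ _) _.
  apply: (@le_trans _ _ (\sum_(i < d) (2 * d)%N%:R^-1)).
    apply: ler_sum => i _; apply: le_trans (bK i) _.
    rewrite lef_pV2 ?posrE ?ltr0n ?muln_gt0 ?dpos //=; last by case: eqP.
    by rewrite ler_nat leq_pmulr //; case: eqP.
  rewrite sumr_const card_ord -[_ *+ d]mulr_natr natrM invfM mulfVK //.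
  by rewrite pnatr_eq0 -lt0n.
have rm i : `|r i| <= (m%:R * (X i)%:R)^-1.
  have [->|ii0] := eqVneq i i0; last first.
    apply: ltW; apply: lt_le_trans (rK i) _; rewrite /K (negPf ii0) -natrM.
    rewrite lef_pV2 ?posrE ?ltr0n ?muln_gt0 ?dpos ?X0 //=.
    by rewrite ler_nat mulnC leq_mul // leq_pmull // muln_gt0.
  have bX : `|(b i0)%:~R| = (X i0)%:R :> R.
    rewrite -intr_norm -abszE /X /height.
    by congr (_%:R); apply/esym/maxn_idPr; rewrite absz_gt0.
  rewrite invfM ler_pdivlMr // -bX mulrC -normrM.
  move/esym/eqP: relE; rewrite (bigD1 i0) //= eq_sym -subr_eq => /eqP <-.
  apply: le_trans (ler_normB _ _) _.
  suff : `|\sum_(i < d | i != i0) (b i)%:~R * r i| <= (2 * m%:R)^-1.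
    have -> : m%:R^-1 = (2 * m%:R)^-1 + (2 * m%:R)^-1 :> R by field; exact: lt0r_neq0.
    by move: hd; clear; lra.
  apply: le_trans (ler_norm_sum _ _ _) _.
  apply: (@le_trans _ _ (\sum_(i < d | i != i0) (2 * d * m)%N%:R^-1)).
    by apply: ler_sum => j /negPf jj0; have := bK j; rewrite jj0.
  rewrite sumr_const cardD1 -[_ *+ d.-1]mulr_natr !natrM !invfM mulrAC.
  rewrite ler_wpM2r ?invr_ge0 // -mulrA ler_piMr // ?invr_ge0 //.
  by rewrite ler_pdivrMl ?ltr0n // mulr1 ler_nat leq_pred.
have := bad h h0 a; apply/negP; rewrite -ltNge.
have prodr : \prod_i `|h%:R * al i - (a i)%:~R| <= ((m ^ d * \prod_i X i)%N%:R)^-1.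
  have -> : (m ^ d * \prod_i X i)%N%:R^-1 = \prod_(i < d) (m%:R * (X i)%:R)^-1 :> R.
    rewrite prodfV big_split /= prodr_const card_ord natrM natr_prod natrX //.
  by apply: ler_prod => i _; rewrite normr_ge0 rm.
apply: (@le_lt_trans _ _ (T%:R / m%:R * (m ^ d * \prod_i X i)%N%:R^-1)).
  by apply: ler_pM => //; [exact: prodr_ge0 | exact: ltW].
apply: le_lt_trans (_ : 2 * D%:R / m%:R < c); last first.
  by rewrite ltr_pdivrMr // -ltr_pdivrMl // mulrC.
rewrite mulrAC ler_wpM2r ?invr_ge0 ?ler0n // ler_pdivrMr; last first.
  by rewrite ltr0n muln_gt0 expn_gt0.
apply: le_trans T2 _; rewrite -mulrA ler_wpM2l // -natrM ler_nat.
by rewrite [leqRHS]mulnCA mulnA.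
Qed.

(** * Counting and summing over dual vectors *)

Definition nint (R : realType) (x : R) : int := Num.floor (x + 2^-1).
Definition sdist (R : realType) (x : R) : R := x - (nint x)%:~R.

Lemma sdist_le (R : realType) (x : R) : `|sdist x| <= 2^-1.
Proof.
have /andP[] := floor_itv (x + 2^-1); rewrite /sdist /nint intrD ler_norml.
by move=> ? ?; apply/andP; split; lra.
Qed.

(** The integers of absolute value at most [m], indexed by a finite type so
    that products of sums over them can be expanded. *)
Definition cint (m : nat) (i : 'I_m.*2.+1) : int := i%:Z - m%:Z.

Lemma cint_inj m : injective (@cint m).
Proof. by move=> i j /addIr [] /val_inj. Qed.

Definition linform (R : realType) d m (al : 'I_d -> R)
  (b : {ffun 'I_d -> 'I_m.*2.+1}) : R := \sum_i (cint (b i))%:~R * al i.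

(** Together with the zero vector, the vectors counted here have values
    [sdist (linform al b)] in [[-Y, Y]], any two of which are at distance at
    least [c / \prod_i (2 * X i)] because their difference is again an integer
    vector of the dual problem, in a box twice as large.  Rounding to
    multiples of that distance is thus injective; the slot used by the zero
    vector removes the usual additive constant. *)
Lemma card_dual_box (R : realType) (d m : nat) (c : R) (al : 'I_d -> R)
    (X : 'I_d -> R) (Y : R) :
  0 < c ->
  dual_bad c al ->
  (forall i, 1 <= X i) -> 0 <= Y ->
  #|[set b : {ffun 'I_d -> 'I_m.*2.+1} | [exists i, cint (b i) != 0] &
      [forall i, `|(cint (b i))%:~R| <= X i] && (`|sdist (linform al b)| <= Y)]|%:R
    <= 2 * Y * (\prod_i (2 * X i)) / c.
Proof.
move=> c0 dual X1 Y0.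
set S := [set b | _ & _].
have mlt : (m < m.*2.+1)%N by rewrite ltnS -addnn leq_addr.
pose z0 : {ffun 'I_d -> 'I_m.*2.+1} := [ffun=> Ordinal mlt].
pose P := \prod_i (2 * X i).
have P0 : 0 < P by apply: prodr_gt0 => i _; have := X1 i; lra.
pose f (b : {ffun 'I_d -> 'I_m.*2.+1}) := (sdist (linform al b) + Y) * P / c.
pose M := Num.truncn (2 * Y * P / c).
have z0S : z0 \notin S.
  rewrite inE negb_and; apply/orP; left; apply/existsPn => i.
  by rewrite ffunE /cint subrr.
have inS b : b \in z0 |: S -> (forall i, `|(cint (b i))%:~R| <= X i) /\
    `|sdist (linform al b)| <= Y.
  rewrite !inE => /orP[/eqP -> | /and3P[_ /forallP ? ?]] //.
  have -> : linform al z0 = 0.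
    by apply: big1 => i _; rewrite ffunE /cint subrr mul0r.
  split=> [i|]; first by rewrite ffunE /cint subrr normr0 (le_trans ler01).
  rewrite /sdist /nint !add0r (_ : Num.floor 2^-1 = 0) ?oppr0 ?normr0 //.
  by apply: floor_def; apply/andP; split; lra.
have f0 b : b \in z0 |: S -> 0 <= f b <= 2 * Y * P / c.
  move=> /inS[_]; rewrite ler_norml => /andP[? ?].
  rewrite /f divr_ge0 ?mulr_ge0 ?(ltW c0) ?(ltW P0) //=; last by lra.
  by rewrite ler_pM2r ?invr_gt0 // ler_pM2r //; lra.
have fM b : b \in z0 |: S -> (Num.truncn (f b) < M.+1)%N.
  by move=> /f0/andP[_ /le_truncn]; rewrite ltnS.
have cardS : (#|z0 |: S| <= M.+1)%N.
  rewrite -[leqRHS]card_ord -(@card_in_imset _ _ (fun b => inord (Num.truncn (f b)) : 'I_M.+1)).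
    exact: max_card.
  move=> b b' bS b'S /(congr1 val); rewrite /= !inordK ?fM // => /truncn_eq_dist.
  have /andP[fb _] := f0 _ bS; have /andP[fb' _] := f0 _ b'S.
  move=> /(_ fb fb'); rewrite /f -!mulrBl.
  rewrite normrM normfV normrM (gtr0_norm P0) (gtr0_norm c0) ltr_pdivrMr // mul1r.
  have -> : sdist (linform al b) + Y - (sdist (linform al b') + Y) =
    \sum_i (cint (b i) - cint (b' i))%:~R * al i -
    (nint (linform al b) - nint (linform al b'))%:~R.
    rewrite (_ : \sum_i _ = linform al b - linform al b'); last first.
      by rewrite -sumrB; apply: eq_bigr => i _; rewrite intrB mulrBl.
    by rewrite /sdist intrB; move: (linform al b) (linform al b') => u v; ring.
  move=> lt_c; apply/ffunP => i; apply/eqP; apply: contraTT lt_c => neq.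
  rewrite -leNgt; apply: le_trans (dual (fun j => cint (b j) - cint (b' j)) _ _) _.
    by exists i; rewrite /= subr_eq0; apply: contra neq => /eqP/cint_inj/eqP.
  apply: ler_wpM2l => //; apply: ler_prod => j _; rewrite ler0n /=.
  rewrite natr_max ge_max; apply/andP; split; first by have := X1 j; lra.
  rewrite natr_absz intr_norm intrB.
  apply: le_trans (ler_normB _ _) _.
  have := (inS _ bS).1 j; have := (inS _ b'S).1 j.
  by lra.
have le_M : (#|S| <= M)%N by move: cardS; rewrite cardsU1 z0S add1n ltnS.
have : (M%:R : R) <= 2 * Y * P / c.
  by rewrite truncn_le divr_ge0 ?mulr_ge0 ?(ltW c0) ?(ltW P0).
by apply: le_trans; rewrite ler_nat.
Qed.

(** A dyadic majorant of [min(1, x^-2)], written as a combination of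
    indicators so that sums of products of it become cardinals of boxes.  It is
    valid for arguments up to the last scale, [2 ^ U.-1]. *)
Definition decay (R : realType) (U : nat) (x : R) : R :=
  \sum_(u < U) 4 * (4^-1) ^+ u * (x <= 2 ^+ u)%R%:R.

(** The smallest [u] with [x <= 2 ^ u] has [x > 2 ^ (u - 1)] unless [u = 0]; the
    factor [4] in [decay] absorbs the loss. *)
Lemma le_decay (R : realType) (U : nat) (a K x : R) :
  0 <= K -> a <= K -> a * x ^+ 2 <= K -> x < 2 ^+ U -> a <= K * decay U.+1 x.
Proof.
move=> K0 aK axK xU.
have exu : exists u, x <= 2 ^+ u by exists U; exact: ltW.
have [u xu umin] := ex_minnP exu.
have uU : (u < U.+1)%N by rewrite ltnS umin // ltW.
have t0 (v : nat) : 0 <= 4 * (4^-1) ^+ v * (x <= 2 ^+ v)%R%:R :> R.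
  by rewrite mulr_ge0 ?ler0n // mulr_ge0 // exprn_ge0 // invr_ge0.
apply: (@le_trans _ _ (K * (4 * (4^-1) ^+ u))); last first.
  rewrite ler_wpM2l // /decay (bigD1 (Ordinal uU)) //= xu mulr1 lerDl.
  by apply: sumr_ge0 => v _; exact: t0.
case: u umin {xu uU} => [|u] umin; first by rewrite expr0 mulr1; lra.
have ux : 2 ^+ u < x by rewrite ltNge; apply/negP => /umin; rewrite ltnn.
rewrite exprS mulVKf ?pnatr_eq0 // exprVn ler_pdivlMr ?exprn_gt0 //.
have [a0|a0] := lerP a 0.
  by apply: le_trans K0; rewrite mulr_le0_ge0 // exprn_ge0.
apply: le_trans axK; rewrite ler_pM2l //.
rewrite (_ : 4 ^+ u = 2 ^+ u * 2 ^+ u :> R); last by rewrite -exprMn -natrM.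
by rewrite expr2 ler_pM ?exprn_ge0 // ltW.
Qed.

Lemma sum_half_lt2 (R : realType) (U : nat) : \sum_(u < U) (2^-1 : R) ^+ u <= 2.
Proof.
suff -> : \sum_(u < U) (2^-1 : R) ^+ u = 2 - 2 * 2^-1 ^+ U.
  have : 0 <= (2^-1 : R) ^+ U by rewrite exprn_ge0 // invr_ge0.
  by lra.
elim: U => [|U IH]; first by rewrite big_ord0 expr0; ring.
by rewrite big_ord_recr /= IH exprS; field.
Qed.

(** Expanding the products of [decay] writes the sum as one over dyadic boxes,
    of weight [4^-u_1 ... 4^-u_d 4^-v] up to constants.  The box contains at
    most [2^u_1 ... 2^u_d 2^v / (N rho_1 ... rho_d)] nonzero vectors, up to a
    constant, so what remains is a product of convergent geometric series. *)
Lemma dual_sum_bound (R : realType) (d m U : nat) (c N : R) (al rho : 'I_d -> R) :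
  0 < c ->
  dual_bad c al ->
  (forall i, 0 < rho i <= 1) -> 0 < N ->
  \sum_(b : {ffun 'I_d -> 'I_m.*2.+1} | [exists i, cint (b i) != 0])
     (\prod_i decay U (rho i * `|(cint (b i))%:~R|)) *
        decay U (N * `|sdist (linform al b)|)
    <= 16 * 16 ^+ d / (c * (N * \prod_i rho i)).
Proof.
move=> c0 dual rho01 N0.
have rho0 i : 0 < rho i by case/andP: (rho01 i).
pose w (u : nat) : R := 4 * (4^-1) ^+ u.
have w0 u : 0 <= w u by rewrite /w mulr_ge0 // exprn_ge0 // invr_ge0.
have Prho : 0 < \prod_i rho i by exact: prodr_gt0.
pose S (u : {ffun 'I_d -> 'I_U}) (v : 'I_U) :=
  [set b : {ffun 'I_d -> 'I_m.*2.+1} | [exists i, cint (b i) != 0] &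
    [forall i, `|(cint (b i))%:~R| <= 2 ^+ u i / rho i] &&
     (`|sdist (linform al b)| <= 2 ^+ v / N)].
pose W (u : {ffun 'I_d -> 'I_U}) (v : 'I_U) := (\prod_i w (u i)) * w v.
have W0 u v : 0 <= W u v by rewrite /W mulr_ge0 ?w0 //; apply: prodr_ge0 => i _; exact: w0.
apply: (@le_trans _ _ (\sum_u \sum_v W u v * #|S u v|%:R)).
  apply: le_of_eq.
  pose ind (u : {ffun 'I_d -> 'I_U}) (v : 'I_U) (b : {ffun 'I_d -> 'I_m.*2.+1}) : R :=
    (\prod_i (rho i * `|(cint (b i))%:~R| <= 2 ^+ u i)%R%:R) *
    (N * `|sdist (linform al b)| <= 2 ^+ v)%R%:R.
  rewrite (eq_bigr (fun b => \sum_u \sum_v W u v * ind u v b)); last first.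
    move=> b _; rewrite /decay bigA_distr_bigA /= mulr_suml; apply: eq_bigr => u _.
    rewrite mulr_sumr; apply: eq_bigr => v _.
    by rewrite big_split /= mulrACA.
  rewrite exchange_big /=; apply: eq_bigr => u _.
  rewrite exchange_big /=; apply: eq_bigr => v _.
  rewrite -mulr_sumr; congr (_ * _).
  rewrite -sum1_card natr_sum big_mkcond [RHS]big_mkcond /=.
  apply: eq_bigr => b _; rewrite inE; case: [exists _, _] => //=.
  rewrite /ind [N * _]mulrC -ler_pdivlMr //.
  have [/forallP ub|] := boolP [forall i, `|(cint (b i))%:~R| <= 2 ^+ u i / rho i].
    rewrite big1 ?mul1r => [|i _]; first by case: (_ <= 2 ^+ v / N).
    by rewrite mulrC -ler_pdivlMr // ub.
  rewrite negb_forall => /existsP[i ui].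
  by rewrite (bigD1 i) //= [rho i * _]mulrC -ler_pdivlMr // (negPf ui) !mul0r.
apply: (@le_trans _ _ (\sum_(u : {ffun 'I_d -> 'I_U}) \sum_(v < U)
    (8 * 8 ^+ d / (c * (N * \prod_i rho i))) *
      ((\prod_i 2^-1 ^+ u i) * 2^-1 ^+ v))).
  apply: ler_sum => u _; apply: ler_sum => v _.
  have X1 i : 1 <= 2 ^+ u i / rho i.
    rewrite ler_pdivlMr // mul1r (@le_trans _ _ 1) //; first by case/andP: (rho01 i).
    by rewrite exprn_ege1 // ler1n.
  have Y0 : 0 <= 2 ^+ v / N by rewrite divr_ge0 ?exprn_ge0 // ltW.
  apply: le_trans (ler_wpM2l (W0 u v) (card_dual_box m c0 dual X1 Y0)) _.
  apply: le_of_eq.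
  have wE k : w k = 4 * 2^-1 ^+ k * 2^-1 ^+ k.
    by rewrite /w -mulrA -exprMn -invfM -natrM.
  have PE : (\prod_i w (u i)) * (\prod_i (2 * (2 ^+ u i / rho i))) =
      8 ^+ d * (\prod_i 2^-1 ^+ u i) / \prod_i rho i.
    have -> : (8 : R) ^+ d = \prod_(i < d) 8 by rewrite prodr_const card_ord.
    rewrite -prodfV -!big_split /=.
    apply: eq_bigr => i _; rewrite wE exprVn; field.
    by rewrite (lt0r_neq0 (rho0 i)) expf_neq0 ?pnatr_eq0.
  have -> : forall p q x y z : R, p * q * (2 * x * y / z) = (p * y) * (2 * q * x / z).
    by move=> *; ring.
  rewrite PE wE exprVn; field.
  by rewrite !lt0r_neq0 ?exprn_gt0.
set A := 8 * 8 ^+ d / _; pose q : R := \sum_(v < U) 2^-1 ^+ v.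
have q0 : 0 <= q by apply: sumr_ge0 => v _; rewrite exprn_ge0 // invr_ge0.
have -> : \sum_(u : {ffun 'I_d -> 'I_U}) \sum_(v < U)
    A * ((\prod_i 2^-1 ^+ u i) * 2^-1 ^+ v) = A * (q ^+ d * q).
  have -> : q ^+ d = \prod_(i < d) q by rewrite prodr_const card_ord.
  rewrite bigA_distr_bigA /= big_distrlr mulr_sumr /=.
  by apply: eq_bigr => u _; rewrite mulr_sumr.
have A0 : 0 <= A.
  by rewrite divr_ge0 ?mulr_ge0 ?exprn_ge0 ?(ltW c0) ?(ltW N0) ?(ltW Prho).
apply: (@le_trans _ _ (A * (2 ^+ d * 2))).
  rewrite ler_wpM2l // ler_pM ?exprn_ge0 //; last exact: sum_half_lt2.
  by rewrite lerXn2r ?nnegrE // sum_half_lt2.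
apply: le_of_eq; rewrite /A.
have -> : (16 : R) ^+ d = 8 ^+ d * 2 ^+ d by rewrite -exprMn -natrM.
by field; rewrite !lt0r_neq0.
Qed.

(** * Smooth weights *)

Local Open Scope classical_set_scope.

Definition second_diff (R : realType) (w : R -> R) (x h : R) : R :=
  w (x + h + h) - 2 * w (x + h) + w x.

(** What the argument uses of a weight.  The second difference bound stands for
    a bounded second derivative: it is the form in which summation by parts
    consumes it. *)
Definition nice_weight (R : realType) (K : R) (w : R -> R) : Prop :=
  [/\ forall x, 0 <= w x <= K,
      forall x, 2 < `|x| -> w x = 0,
      forall x y, `|w x - w y| <= K * `|x - y|
    & forall x h, 0 <= h -> `|second_diff w x h| <= K * h ^+ 2].

Section smooth.
Variables (R : realType) (w : R -> R).
Hypothesis cd : times_cont_diff 3 w.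

Let der m (x : R) : (m < 3)%N -> is_derive x 1 (derive1n m w) (derive1n m.+1 w x).
Proof.
move=> m3; have /derivableP := cd.1 m m3 x.
by rewrite derive1nS derive1E.
Qed.

Let cont m : (m < 3)%N -> continuous (derive1n m w).
Proof.
move=> m3 x; apply: differentiable_continuous; apply/derivable1_diffP.
exact: cd.1.
Qed.

Lemma derive_mvt m a b : (m < 3)%N -> a <= b ->
  exists2 c, a <= c <= b & derive1n m w b - derive1n m w a = derive1n m.+1 w c * (b - a).
Proof.
move=> m3 ab.
have [||c cab e] := @MVT_segment R (derive1n m w) (derive1n m.+1 w) a b ab.
- by move=> x _; exact: der.
- by apply: continuous_subspaceT; exact: cont.
by exists c; rewrite // -in_itv.
Qed.

Lemma derive_bounded m : (m < 3)%N ->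
  exists2 K, 0 <= K & forall x, -4 <= x <= 4 -> `|derive1n m w x| <= K.
Proof.
move=> m3.
have c : {within `[(-4 : R), 4], continuous (derive1n m w)}.
  by apply: continuous_subspaceT; exact: cont.
have le4 : (-4 : R) <= 4 by lra.
have [u _ uM] := EVT_max le4 c.
have [v _ vM] := EVT_min le4 c.
exists (`|derive1n m w u| + `|derive1n m w v|); first by rewrite addr_ge0.
move=> x xI; have /uM := xI; have /vM := xI; move: (derive1n m w x) => y.
have := ler_norm (derive1n m w u); have := lerNnormlW (lexx `|derive1n m w v|).
have := normr_ge0 (derive1n m w u); have := normr_ge0 (derive1n m w v).
by rewrite ler_norml => ? ? ? ? ? ?; apply/andP; split; lra.
Qed.

Hypothesis w0 : forall x, 0 <= w x.
Hypothesis sw : supp w `<=` `[- 2, 2].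

Lemma supp_zero x : 2 < `|x| -> w x = 0.
Proof.
move=> x2; apply/eqP; apply: contraTT x2 => wx; rewrite -leNgt ler_norml.
have : supp w x by apply: subset_closure.
by move/sw; rewrite /= in_itv.
Qed.

(** The mean value theorem needs bounds for derivatives on a compact interval
    only.  Steps of length at least [1] are handled by the bound for [w] itself,
    and for shorter steps either all points lie in [[-4, 4]] or all of them lie
    outside the support. *)
Lemma smooth_nice : exists2 K, 0 < K & nice_weight K w.
Proof.
have [K0 K00 b0] := @derive_bounded 0 isT.
have [K1 K10 b1] := @derive_bounded 1 isT.
have [K2 K20 b2] := @derive_bounded 2 isT.
pose K := 4 * K0 + K1 + 2 * K2 + 1.
have zl x : x < - 2 -> w x = 0.
  by move=> x2; apply: supp_zero; rewrite ltr_normr; apply/orP; right; lra.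
have zr x : 2 < x -> w x = 0.
  by move=> x2; apply: supp_zero; rewrite ltr_normr x2.
have wK x : 0 <= w x <= K0.
  rewrite w0 /=; have [x2|x2] := leP `|x| 2; last by rewrite supp_zero.
  rewrite -[leLHS]ger0_norm //; apply: b0; move: x2.
  by rewrite ler_norml => /andP[? ?]; apply/andP; split; lra.
exists K; first by rewrite /K; lra.
split.
- by move=> x; have /andP[-> ?] := wK x; rewrite /K /=; lra.
- exact: supp_zero.
- suff H x y : x <= y -> `|w x - w y| <= K * `|x - y|.
    by move=> x y; have [/H//|/ltW/H] := leP x y; rewrite distrC [`|y - x|]distrC.
  move=> xy; rewrite distrC [X in _ * X]distrC [X in _ * X]ger0_norm ?subr_ge0 //.
  have [d1|d1] := leP 1 (y - x).
    have /andP[? ?] := wK x; have /andP[? ?] := wK y.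
    apply: (@le_trans _ _ K0); last by rewrite /K; nra.
    by rewrite ler_norml; apply/andP; split; lra.
  have Kd : 0 <= K * (y - x) by rewrite mulr_ge0 ?subr_ge0 // /K; lra.
  have [x4|x4] := ltP x (- 4).
    by rewrite !zl ?subrr ?normr0 //; lra.
  have [x3|x3] := ltP 3 x.
    by rewrite !zr ?subrr ?normr0 //; lra.
  have [c /andP[c1 c2]] := @derive_mvt 0 x y isT xy.
  rewrite !derive1n0 => ->; rewrite normrM (ger0_norm (_ : 0 <= y - x)) ?subr_ge0 //.
  rewrite ler_wpM2r ?subr_ge0 //; apply: le_trans (b1 _ _) _; first by apply/andP; split; lra.
  by rewrite /K; lra.
- move=> x h h0; rewrite /second_diff.
  have /andP[? ?] := wK x; have /andP[? ?] := wK (x + h).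
  have /andP[? ?] := wK (x + h + h).
  have [h1|h1] := leP 1 h.
    apply: (@le_trans _ _ (4 * K0)); last first.
      by rewrite (@le_trans _ _ K) ?ler_peMr ?exprn_ege1 //; rewrite /K; lra.
    by rewrite ler_norml; apply/andP; split; lra.
  have Kd : 0 <= K * h ^+ 2 by rewrite mulr_ge0 ?sqr_ge0 // /K; lra.
  have [x4|x4] := ltP x (- 4).
    by rewrite !zl ?mulr0 ?subrr ?addr0 ?normr0 //; lra.
  have [x2|x2] := ltP 2 x.
    by rewrite !zr ?mulr0 ?subrr ?addr0 ?normr0 //; lra.
  (* Two first differences, at points less than [2 * h] apart. *)
  have [|c /andP[c1 c2]] := @derive_mvt 0 x (x + h) isT; first by lra.
  have [|c' /andP[c1' c2']] := @derive_mvt 0 (x + h) (x + h + h) isT; first by lra.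
  have [|e /andP[e1 e2] eE] := @derive_mvt 1 c c' isT; first by lra.
  rewrite !derive1n0 => E1 E2.
  have -> : w (x + h + h) - 2 * w (x + h) + w x =
      derive1n 2 w e * ((c' - c) * h).
    by rewrite mulrA -eE; move: E1 E2; nra.
  apply: (@le_trans _ _ (K2 * (2 * h ^+ 2))).
    rewrite normrM ler_pM //; first by apply: b2; apply/andP; split; lra.
    by rewrite ger0_norm ?mulr_ge0 // ?subr_ge0; nra.
  have : 0 <= h ^+ 2 by exact: sqr_ge0.
  by rewrite /K; nra.
Qed.

End smooth.

Definition mass (R : realType) (w : R -> R) : R := \int[@lebesgue_measure R]_x w x.

Lemma Re_fourier0 (R : realType) (w : R -> R) :
  complex.Re (fourier w 0) = mass w.
Proof.
rewrite /fourier /mass /=; apply: eq_Rintegral => x _.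
by rewrite /cexp_2pi !(oppr0, mul0r, mulr0) cos0 mulr1 addr0.
Qed.

Section antiderivative.
Variables (R : realType) (K : R) (w : R -> R).
Hypothesis nw : nice_weight K w.
Hypothesis cw : continuous w.
Notation mu := (@lebesgue_measure R).

Let w_itv : w \_ `[-2, 2] = w.
Proof.
apply/funext => x; rewrite /patch; case: ifPn => // /negP xI.
case: nw => _ /(_ x) z _ _; rewrite z // ltNge; apply/negP => x2; apply: xI.
by rewrite inE /= in_itv /= -ler_norml.
Qed.

Let intw (D : set R) : measurable D -> mu.-integrable D (EFin \o w).
Proof.
move=> mD; apply: (@integrableS _ _ _ mu setT) => //.
rewrite -w_itv -restrict_EFin; apply: (iffLR (integrable_mkcond _ _)) => //.
apply: continuous_compact_integrable; first exact: segment_compact.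
exact: continuous_subspaceT.
Qed.

Let F (x : R) : R := \int[mu]_(t in `]-oo, x]) w t.

Let F_derive (x : R) : is_derive x 1 F (w x).
Proof.
have [] := @continuous_FTC1 R w -oo%O x (x + 1) _ _ _ (@cw x).
- by rewrite ltrDl.
- exact: intw.
- by rewrite ltNyr.
by move=> dF <-; rewrite derive1E; exact/derivableP.
Qed.

Let F_left x : x < - 2 -> F x = 0.
Proof.
move=> x2; rewrite /F (@eq_Rintegral _ _ _ _ _ (cst 0)) ?Rintegral_cst ?mul0r //.
move=> t; rewrite inE /= in_itv /= => tx; case: nw => _ z _ _.
by apply: z; rewrite ltr_normr; apply/orP; right; lra.
Qed.

Let F_right x : 2 < x -> F x = mass w.
Proof.
move=> x2; rewrite /F Rintegral_mkcond /mass; congr Rintegral.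
apply/funext => t; rewrite /patch; case: ifPn => // /negP tI.
case: nw => _ /(_ t) z _ _; rewrite z // ltr_normr; apply/orP; left.
apply: lt_trans x2 _; rewrite ltNge; apply/negP => tx; apply: tI.
by rewrite inE /= in_itv.
Qed.

(** Each increment of the antiderivative over a mesh interval is a value of [w]
    in that interval divided by [M], so comparing with the left endpoint costs
    the Lipschitz constant times [1 / M], once per interval. *)
Lemma riemann_sum (M : R) (H : nat) : 0 < M -> 2 * M < H%:R ->
  `|\sum_(i < H.*2) w ((i%:R - H%:R) / M) - M * mass w| <= K * (H.*2)%:R / M.
Proof.
move=> M0 HM.
pose x (i : nat) : R := (i%:R - H%:R) / M.
have xS i : x i.+1 - x i = M^-1 by rewrite /x -natr1; field; exact: lt0r_neq0.
have tel : mass w = \sum_(i < H.*2) (F (x i.+1) - F (x i)).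
  rewrite -(big_mkord xpredT (fun i => F (x i.+1) - F (x i))) telescope_sumr //.
  have xl : x 0 < - 2 by rewrite /x sub0r mulNr ltrN2 ltr_pdivlMr.
  have xr : 2 < x H.*2 by rewrite /x -addnn natrD addrK ltr_pdivlMr.
  by rewrite (F_left xl) (F_right xr) subr0.
rewrite tel mulr_sumr -sumrB; apply: le_trans (ler_norm_sum _ _ _) _.
apply: (@le_trans _ _ (\sum_(i < H.*2) (K / M))); last first.
  by rewrite sumr_const card_ord -[_ *+ _]mulr_natr mulrAC.
apply: ler_sum => i _.
have lx : x i <= x i.+1 by rewrite -subr_ge0 xS invr_ge0 ltW.
have [|c] := @MVT_segment R F w (x i) (x i.+1) lx (fun t _ => F_derive t).
  by apply: derivable_within_continuous => t _; have [] := F_derive t.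
rewrite in_itv /= => /andP[c1 c2] ->; rewrite xS mulrCA mulfV ?lt0r_neq0 // mulr1.
case: nw => wK _ /(_ (x i) c) lip _; apply: le_trans lip _.
have K0 : 0 <= K by have /andP[] := wK 0; exact: le_trans.
rewrite ler_wpM2l // distrC ger0_norm ?subr_ge0 // -(xS i).
by rewrite lerD2r.
Qed.

End antiderivative.

Lemma weight_class_nice (R : realType) (k : nat) (omega : 'I_k -> R -> R) :
  weight_class 3 omega ->
  exists2 K : R, 0 < K & forall i, [/\ nice_weight K (omega i), continuous (omega i)
    & 0 < mass (omega i)].
Proof.
move=> W.
have H i : exists K : R, 0 < K /\ nice_weight K (omega i).
  by have [w0 cd sw _ _] := W i; have [K K0 n] := smooth_nice cd w0 sw; exists K.
have [K KP] := choice H.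
exists (\sum_i K i + 1).
  by rewrite ltr_wpDl // sumr_ge0 // => i _; rewrite ltW // (KP i).1.
move=> i; have KK : K i <= \sum_i K i + 1.
  rewrite (bigD1 i) //= -addrA lerDl addr_ge0 // sumr_ge0 // => j _.
  by rewrite ltW // (KP j).1.
have [w0 cd sw _ f0] := W i; split.
- have [_ [a b c d]] := KP i; split => //.
  + by move=> x; have /andP[-> /le_trans ->] := a x.
  + by move=> x y; apply: le_trans (c x y) _; rewrite ler_wpM2r.
  + by move=> x h h0; apply: le_trans (d x h h0) _; rewrite ler_wpM2r ?sqr_ge0.
- move=> x; apply: differentiable_continuous; apply/derivable1_diffP.
  exact: (cd.1 0 isT).
- by move: f0; rewrite -Re_fourier0 ltcE /= => /andP[].
Qed.

(** * The exponential function *)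

Local Open Scope complex_scope.

Section modulus.
Variable R : realType.
Implicit Types (x y : R) (z : R[i]).

Lemma normc_real x : normc x%:C = `|x|.
Proof. by rewrite /normc /= expr0n /= addr0 sqrtr_sqr. Qed.

Lemma normc_ge0 z : 0 <= normc z.
Proof. by case: z => a b; exact: sqrtr_ge0. Qed.

Lemma normcD z z' : normc (z + z') <= normc z + normc z'.
Proof. exact: (@le_normcD R). Qed.

Lemma normc_opp z : normc (- z) = normc z.
Proof. exact: (@normcN R). Qed.

Lemma normc_sum (I : Type) (s : seq I) (P : pred I) (F : I -> R[i]) :
  normc (\sum_(i <- s | P i) F i) <= \sum_(i <- s | P i) normc (F i).
Proof.
elim/big_rec2: _ => [|i y z _ le]; first by rewrite normc0.
by apply: le_trans (normcD _ _) _; rewrite lerD2l.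
Qed.

Lemma normc_prod (I : Type) (s : seq I) (P : pred I) (F : I -> R[i]) :
  normc (\prod_(i <- s | P i) F i) = \prod_(i <- s | P i) normc (F i).
Proof.
by elim/big_rec2: _ => [|i y z _ <-]; [exact: normc1 | exact: normcM].
Qed.

End modulus.

Section exponential.
Variable R : realType.
Implicit Types x y : R.

Local Notation e := (@cexp_2pi R).

Lemma cexp0 : e 0 = 1.
Proof. by rewrite /cexp_2pi mulr0 cos0 sin0. Qed.

Lemma cexpD x y : e (x + y) = e x * e y.
Proof.
rewrite /cexp_2pi mulrDr cosD sinD; apply/eqP; rewrite eq_complex /=.
by apply/andP; split; apply/eqP; ring.
Qed.

Lemma normc_cexp x : normc (e x) = 1.
Proof. by rewrite /normc /= cos2Dsin2 sqrtr1. Qed.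

Lemma cexp_sum (I : Type) (s : seq I) (P : pred I) (F : I -> R) :
  e (\sum_(i <- s | P i) F i) = \prod_(i <- s | P i) e (F i).
Proof. by elim/big_rec2: _ => [|i y z _ <-]; [exact: cexp0 | exact: cexpD]. Qed.

Lemma cexp_nat n x : e (n%:R * x) = e x ^+ n.
Proof.
elim: n => [|n IH]; first by rewrite mul0r cexp0.
by rewrite -natr1 mulrDl mul1r cexpD IH exprSr.
Qed.

Lemma cexp1 : e 1 = 1.
Proof. by rewrite /cexp_2pi mulr1 mulrC mulr_natr cos2pi sin2pi. Qed.

Lemma cexpN x : e (- x) = (e x)^-1.
Proof.
have E : e (- x) * e x = 1 by rewrite -cexpD addNr cexp0.
apply: (@mulIf _ (e x)); first by apply/eqP => z; move/eqP: E; rewrite z mulr0 eq_sym oner_eq0.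
rewrite E mulVf //.
by apply/eqP => z; move/eqP: E; rewrite z mulr0 eq_sym oner_eq0.
Qed.

Lemma cexp_int (z : int) : e z%:~R = 1.
Proof.
have N n : e n%:R = 1 by rewrite -[n%:R]mulr1 cexp_nat cexp1 expr1n.
by case: z => n; [exact: N | rewrite NegzE intrN cexpN N invr1].
Qed.

Lemma cexpM_int (z : int) x : e (z%:~R * x) = e (z%:~R * sdist x).
Proof.
by rewrite /sdist mulrBr cexpD -intrM -intrN cexp_int mulr1.
Qed.

Lemma normc_cexpB1 x : normc (1 - e x) = 2 * `|sin (pi * x)|.
Proof.
rewrite /normc /=.
have -> : 2 * pi * x = (pi * x) *+ 2 by rewrite mulr2n; ring.
rewrite cos_mulr2n sin_mulr2n cos2sin2.
have -> : (1 - ((1 - sin (pi * x) ^+ 2) *+ 2 - 1)) ^+ 2 +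
    (0 - (cos (pi * x) * sin (pi * x)) *+ 2) ^+ 2 = (2 * sin (pi * x)) ^+ 2.
  have := cos2Dsin2 (pi * x); move: (cos _) (sin _) => c s h.
  have -> : (2 * s) ^+ 2 = (2 * s) ^+ 2 * (c ^+ 2 + s ^+ 2) by rewrite h mulr1.
  ring.
by rewrite sqrtr_sqr normrM ger0_norm.
Qed.

Lemma normr_sin_le x : `|sin x| <= `|x|.
Proof.
wlog x0 : x / 0 <= x.
  move=> H; have [/H //|/ltW x0] := leP 0 x.
  by rewrite -normrN -sinN -[leRHS]normrN H // oppr_ge0.
have [|c _] := @MVT_segment R sin cos 0 x x0 (fun t _ => is_derive_sin t).
  by apply: continuous_subspaceT; exact: continuous_sin.
rewrite sin0 !subr0 => ->; rewrite normrM ler_piMl // ler_norml cos_geN1 cos_le1.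
by [].
Qed.

Lemma cos_half_ge (x : R) : 0 <= x <= pi / 4 -> 2^-1 <= cos x.
Proof.
move=> /andP[x0 x4]; have p0 := pi_gt0 R.
have c0 : 0 <= cos x by apply: cos_ge0_pihalf; apply/andP; split; lra.
have : 0 <= cos (x *+ 2).
  by apply: cos_ge0_pihalf; rewrite [x *+ 2]mulr2n; apply/andP; split; lra.
rewrite cos_mulr2n; nra.
Qed.

(** Double angle: [sin x = 2 sin (x / 2) cos (x / 2)], where [sin (x / 2)] is a
    value of the cosine times [x / 2], and both cosines are at least [1/2]. *)
Lemma sin_lower (x : R) : `|x| <= pi / 2 -> `|x| / 4 <= `|sin x|.
Proof.
wlog x0 : x / 0 <= x.
  move=> H; have [/H //|/ltW x0] := leP 0 x.
  by rewrite -normrN -[`|sin x|]normrN -sinN; apply: H; rewrite oppr_ge0.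
rewrite (ger0_norm x0) => x2.
have h0 : 0 <= x / 2 by lra.
have [|c] := @MVT_segment R sin cos 0 (x / 2) h0 (fun t _ => is_derive_sin t).
  by apply: continuous_subspaceT; exact: continuous_sin.
rewrite in_itv /= sin0 !subr0 => /andP[c0 cx] sE.
have xE : x = (x / 2) *+ 2 by rewrite [_ *+ 2]mulr2n; lra.
have := ler_norm (sin x); rewrite {1}xE sin_mulr2n sE.
have : 2^-1 <= cos (x / 2) by apply: cos_half_ge; apply/andP; split; lra.
have : 2^-1 <= cos c by apply: cos_half_ge; apply/andP; split; lra.
set u := cos c; set v := cos (x / 2); move=> u2 v2 le.
apply: le_trans le; rewrite [_ *+ 2]mulr2n.
have : 4^-1 <= v * u by nra.
nra.
Qed.

Lemma cexpB1_lower x : `|x| <= 2^-1 -> `|x| <= normc (1 - e x).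
Proof.
move=> x2; rewrite normc_cexpB1.
have p2 := pi_ge2 R; have nx := normr_ge0 x.
have := @sin_lower (pi * x); rewrite normrM (ger0_norm (pi_ge0 R)) => H.
have : pi * `|x| <= pi / 2 by rewrite ler_wpM2l ?pi_ge0.
move=> /H; nra.
Qed.

Lemma cexpB_upper x y : normc (e x - e y) <= 2 * pi * `|x - y|.
Proof.
have -> : e x - e y = - (e y * (1 - e (x - y))).
  by rewrite mulrBr mulr1 -cexpD opprB [y + _]addrC addrNK.
rewrite normc_opp normcM normc_cexp mul1r normc_cexpB1 -mulrA ler_wpM2l //.
by apply: le_trans (normr_sin_le _) _; rewrite normrM ger0_norm ?pi_ge0.
Qed.

End exponential.

(** * Exponential sums *)

Definition zsum (V : nmodType) (H : nat) (F : int -> V) : V :=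
  \sum_(i < H.*2.+1) F (cint i).

Lemma zsumS (V : nmodType) (H : nat) (F : int -> V) :
  zsum H.+1 F = F (- H.+1%:Z) + zsum H F + F H.+1%:Z.
Proof.
rewrite /zsum /cint doubleS big_ord_recl big_ord_recr /= addrA; congr (_ + _ + _).
- by rewrite sub0r.
- by apply: eq_bigr => i _; congr F; rewrite /bump /=; lia.
- by congr F; rewrite /bump /= -addnn; lia.
Qed.

Lemma zsum_widen (V : nmodType) (H H' : nat) (F : int -> V) :
  (H <= H')%N -> (forall a, (H < `|a|)%N -> F a = 0) -> zsum H' F = zsum H F.
Proof.
move=> HH F0; rewrite -(subnKC HH); elim: (H' - H)%N => [|k IH]; first by rewrite addn0.
by rewrite addnS zsumS IH !F0 ?add0r ?addr0 //; lia.
Qed.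

Section expsum.
Variables (R : realType) (K : R) (w : R -> R).
Hypothesis nw : nice_weight K w.

Definition expsum (M th : R) (H : nat) : R[i] :=
  zsum H (fun a => (w (a%:~R / M))%:C * cexp_2pi (a%:~R * th)).

Let K0 : 0 <= K. Proof. by case: nw => wK _ _ _; have /andP[a /(le_trans a)] := wK 0. Qed.

Lemma weight_out (M : R) (a : int) : 0 < M -> 2 * M < `|a%:~R| -> w (a%:~R / M) = 0.
Proof.
move=> M0 Ma; case: nw => _ z _ _; apply: z.
by rewrite normrM normfV (gtr0_norm M0) ltr_pdivlMr.
Qed.

Lemma weight_out_nat (M : R) (H : nat) (a : int) :
  0 < M -> 2 * M <= H%:R -> (H < `|a|)%N -> w (a%:~R / M) = 0.
Proof.
move=> M0 MH Ha; apply: weight_out => //; apply: le_lt_trans MH _.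
by rewrite -intr_norm -natr_absz ltr_nat.
Qed.

Let H0 (M : R) := (Num.truncn (2 * M)).+3.

Let H0P (M : R) : 1 <= M -> 2 * M + 2 < (H0 M)%:R <= 2 * M + 3.
Proof.
move=> M1; have /andP[] : (Num.truncn (2 * M))%:R <= 2 * M < (Num.truncn (2 * M)).+1%:R.
  by apply: truncn_itv; lra.
by rewrite /H0 -natr1 -[_.+3%:R]natr1 -[_.+2%:R]natr1 -natr1 => ? ?; apply/andP; split; lra.
Qed.

Lemma expsum_widen (M th : R) H : 1 <= M -> 2 * M + 3 <= H%:R ->
  expsum M th H = expsum M th (H0 M).
Proof.
move=> M1 MH; have /andP[h1 h2] := H0P M1; apply: zsum_widen.
  by rewrite -(ler_nat R) (le_trans h2).
by move=> a /(@weight_out_nat M) -> //; rewrite ?mul0r //; lra.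
Qed.

(** Summation by parts, twice: multiplying the sum by [(1 - e (- th))^2] replaces
    the weight by its second differences, each of size [K / M ^ 2], and there are
    at most [11 * M] terms.  The factor [1 - e (- th)] is at least the distance
    from [th] to the integers. *)
Lemma expsum_bound (M th : R) (H : nat) : 1 <= M -> 2 * M + 3 <= H%:R ->
  normc (expsum M th H) <= 11 * K * M /\
  normc (expsum M th H) * (M * `|sdist th|) ^+ 2 <= 11 * K * M.
Proof.
move=> M1 MH; rewrite expsum_widen //; have /andP[h1 h2] := H0P M1.
set h := H0 M in h1 h2 *.
have nM : (h.*2.+1)%:R <= 11 * M by rewrite -natr1 -addnn natrD; lra.
have M0 : 0 < M by lra.
have [wK wz _ w2] := nw.
split.
  apply: le_trans (normc_sum _ _ _) _.
  apply: (@le_trans _ _ (\sum_(i < h.*2.+1) K)).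
    apply: ler_sum => i _; rewrite normcM normc_cexp mulr1 normc_real.
    by have /andP[? ?] := wK ((cint i)%:~R / M); rewrite ger0_norm.
  by rewrite sumr_const card_ord -[_ *+ _]mulr_natr (mulrC 11) -mulrA ler_wpM2l.
pose x (i : nat) : R := (i%:R - h%:R) / M.
pose E (i : nat) : R[i] := cexp_2pi ((i%:R - h%:R) * th).
pose G (i : nat) : R[i] := (w (x i))%:C * E i.
have SE : expsum M th h = \sum_(i < h.*2.+1) G i.
  by apply: eq_bigr => i _; rewrite /cint intrB.
have Gl i : (i <= 1)%N -> G i = 0.
  move=> i1; rewrite /G wz ?mul0r // /x normrM normfV (gtr0_norm M0) ltr_pdivlMr //.
  have : (i%:R : R) <= 1 by rewrite lern1.
  by move=> ?; rewrite ltr_normr; apply/orP; right; lra.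
have Gr i : (h.*2 <= i)%N -> G i = 0.
  move=> i1; rewrite /G wz ?mul0r // /x normrM normfV (gtr0_norm M0) ltr_pdivlMr //.
  have : ((h.*2)%:R : R) <= i%:R by rewrite ler_nat.
  by rewrite -addnn natrD => ?; rewrite ltr_normr; apply/orP; left; lra.
(* The range of summation exceeds the support of the weight by two on each
   side, so that shifting it by one or two changes nothing. *)
have shift (u : nat -> R[i]) : u 0%N = 0 -> u h.*2.+1 = 0 ->
    \sum_(i < h.*2.+1) u i.+1 = \sum_(i < h.*2.+1) u i.
  move=> u0 un; have := @big_ord_recl _ 0 +%R h.*2.+1 (fun i => u i).
  by rewrite big_ord_recr /= u0 un addr0 add0r => <-.
have S1 : \sum_(i < h.*2.+1) G i.+1 = expsum M th h.
  by rewrite SE; apply: shift; [apply: Gl | apply: Gr; rewrite leqnSn].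
have S2 : \sum_(i < h.*2.+1) G i.+2 = expsum M th h.
  rewrite -S1; apply: (shift (fun i => G i.+1)); first exact: Gl.
  by apply: Gr; rewrite leqW // leqnSn.
have key : \sum_(i < h.*2.+1) (second_diff w (x i) M^-1)%:C * E i =
    (1 - cexp_2pi (- th)) ^+ 2 * expsum M th h.
  have -> : (1 - cexp_2pi (- th)) ^+ 2 * expsum M th h =
    cexp_2pi (- th) * cexp_2pi (- th) * expsum M th h
     - 2 * cexp_2pi (- th) * expsum M th h + expsum M th h by ring.
  rewrite -{1}S2 -{1}S1 {1}SE !mulr_sumr -sumrB -big_split /=.
  apply: eq_bigr => i _.
  have xS j : x j.+1 = x j + M^-1.
    by rewrite /x -natr1; field; exact: lt0r_neq0.
  have ES j : cexp_2pi (- th) * E j.+1 = E j.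
    by rewrite /E -cexpD -natr1; congr cexp_2pi; ring.
  rewrite /second_diff -!xS rmorphD rmorphB rmorphM /= /G.
  rewrite -(ES i) -(ES i.+1) (_ : 2%:C = 2); last by rewrite rmorph_nat.
  by ring.
have lower : normc (1 - cexp_2pi (- th)) = normc (1 - cexp_2pi (- sdist th)).
  by have := cexpM_int (-1) th; rewrite !mulN1r => ->.
have := cexpB1_lower (x := - sdist th); rewrite normrN -lower => /(_ (sdist_le th)) low.
have up : normc (1 - cexp_2pi (- th)) ^+ 2 * normc (expsum M th h) <= 11 * K / M.
  rewrite expr2 -normcM -normcM -expr2 -key.
  apply: le_trans (normc_sum _ _ _) _.
  apply: (@le_trans _ _ (\sum_(i < h.*2.+1) (K * M^-1 ^+ 2))).
    apply: ler_sum => i _; rewrite normcM normc_cexp mulr1 normc_real.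
    by apply: w2; rewrite invr_ge0 ltW.
  rewrite sumr_const card_ord -[_ *+ _]mulr_natr.
  apply: (@le_trans _ _ (K * M^-1 ^+ 2 * (11 * M))).
    by rewrite ler_wpM2l // mulr_ge0 // exprn_ge0 // invr_ge0 ltW.
  by apply: le_of_eq; field; exact: lt0r_neq0.
have -> : 11 * K * M = 11 * K / M * M ^+ 2 by field; exact: lt0r_neq0.
rewrite exprMn mulrCA mulrC ler_wpM2r ?sqr_ge0 //.
apply: le_trans up; rewrite mulrC ler_wpM2r ?normc_ge0 //.
by rewrite lerXn2r ?nnegrE ?normc_ge0.
Qed.

Lemma zsum_riemann (M : R) (H : nat) : continuous w -> 1 <= M -> 2 * M + 3 <= H%:R ->
  `|zsum H (fun a => w (a%:~R / M)) - M * mass w| <= 10 * K.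
Proof.
move=> cw M1 MH; have /andP[h1 h2] := H0P M1.
have M0 : 0 < M by lra.
rewrite (@zsum_widen _ (H0 M)); first last.
- by move=> a /(@weight_out_nat M) -> //; lra.
- by rewrite -(ler_nat R) (le_trans h2).
have [_ wz _ _] := nw.
rewrite /zsum big_ord_recr /= wz ?addr0; last first.
  rewrite /cint -addnn PoszD addrK normrM normfV (gtr0_norm M0) ltr_pdivlMr //.
  by rewrite ger0_norm //; lra.
have := @riemann_sum R K w nw cw M (H0 M) M0; move=> /(_ _) rs.
apply: le_trans (_ : `|\sum_(i < (H0 M).*2) w ((i%:R - (H0 M)%:R) / M) - M * mass w| <= _).
  apply: le_of_eq; congr (`|_ - _|).
  by apply: eq_bigr => i _; rewrite /cint intrB.
apply: le_trans (rs _) _; first by lra.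
rewrite ler_pdivrMr // [10 * _]mulrC -mulrA ler_wpM2l // -addnn natrD; lra.
Qed.

End expsum.

(** * Trigonometric interpolation *)

Lemma cint_le m (i : 'I_m.*2.+1) : (`|cint i| <= m)%N.
Proof. by have := ltn_ord i; rewrite /cint; move: (nat_of_ord i) => k; lia. Qed.

Lemma zsum_pick (V : nmodType) (H : nat) (j0 : int) (v : V) :
  (`|j0| <= H)%N -> zsum H (fun j => if j == j0 then v else 0) = v.
Proof.
move=> j0H; have lt : (`|(j0 + H%:Z)%R| < H.*2.+1)%N by rewrite -addnn; lia.
rewrite /zsum (bigD1 (Ordinal lt)) //= big1 ?addr0 => [|i].
  by rewrite /cint /= ifT //; apply/eqP; lia.
rewrite -val_eqE /= => ij; rewrite ifF //; apply/negP => /eqP e.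
by move/negP: ij; apply; apply/eqP; rewrite -e /cint; lia.
Qed.

Lemma zsumD (V : nmodType) (H : nat) (F G : int -> V) :
  zsum H (fun j => F j + G j) = zsum H F + zsum H G.
Proof. exact: big_split. Qed.

Lemma eq_zsum (V : nmodType) (H : nat) (F G : int -> V) :
  (forall a : int, (`|a| <= H)%N -> F a = G a) -> zsum H F = zsum H G.
Proof.
by move=> FG; apply: eq_bigr => i _; apply: FG; exact: cint_le.
Qed.

Lemma intr_norm_le_nat (R : realType) (a : int) (n : nat) :
  (`|a%:~R : R| <= n%:R) = (`|a| <= n)%N.
Proof. by rewrite -intr_norm -natr_absz ler_nat. Qed.

Lemma unit_root_sum (R : realType) (m : nat) (t : int) :
  zsum m (fun b => cexp_2pi (b%:~R * (t%:~R / (m.*2.+1)%:R : R))) =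
  if ((m.*2.+1)%:Z %| t)%Z then (m.*2.+1)%:R else 0.
Proof.
set q := m.*2.+1; have q0 : (q%:R : R) != 0 by rewrite pnatr_eq0.
set x := t%:~R / q%:R; pose z := cexp_2pi x.
have -> : zsum m (fun b => cexp_2pi (b%:~R * x)) =
    cexp_2pi (- (m%:R * x)) * \sum_(i < q) z ^+ i.
  rewrite mulr_sumr; apply: eq_bigr => i _.
  by rewrite -cexp_nat -cexpD /cint intrB mulrBl addrC.
case: ifP => [/dvdzP[k tk]|ndvd].
  have xk : x = k%:~R by rewrite /x tk intrM mulfK.
  rewrite /z xk cexp_int -mulrN -[- k%:~R]intrN -[m%:R]/(m%:~R) -intrM cexp_int mul1r.
  under eq_bigr do rewrite expr1n.
  by rewrite sumr_const card_ord.
have zq : z ^+ q = 1.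
  by rewrite -cexp_nat mulrC divfK // cexp_int.
have z1 : z - 1 != 0.
  apply: contraFN ndvd; rewrite -oppr_eq0 opprB => /eqP z1.
  have := cexpB1_lower (sdist_le x); have := cexpM_int 1 x; rewrite !mul1r => <-.
  rewrite z1 normc0 normr_le0 /sdist subr_eq0 => /eqP xe.
  apply/dvdzP; exists (nint x); apply: (@intr_inj R).
  by rewrite intrM -xe /x; apply/esym/divfK.
have : (z - 1) * \sum_(i < q) z ^+ i = 0 by rewrite -subrX1 zq subrr.
by move/eqP; rewrite mulf_eq0 (negPf z1) /= => /eqP ->; rewrite mulr0.
Qed.

Section interpolation.
Variables (R : realType) (K : R) (w : R -> R) (rho : R).
Hypothesis nw : nice_weight K w.
Hypothesis rho01 : 0 < rho < 2^-1.

Let rho0 : 0 < rho. Proof. by case/andP: rho01. Qed.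
Let K0 : 0 <= K. Proof. by case: nw => wK _ _ _; have /andP[a /(le_trans a)] := wK 0. Qed.

(** The discrete Fourier coefficients, with respect to [2 m + 1] equidistant
    nodes, of the periodization of [w (x / rho)].  Unfolding the periodization
    turns them into exponential sums of length about [(2 m + 1) rho]. *)
Definition coef (m : nat) (b : int) : R[i] :=
  ((m.*2.+1)%:R^-1)%:C *
    expsum w ((m.*2.+1)%:R * rho) (- (b%:~R / (m.*2.+1)%:R)) m.*2.+1.

Definition interp (m : nat) (x : R) : R[i] :=
  zsum m (fun b => coef m b * cexp_2pi (b%:~R * x)).

(** As [2 * rho < 1], at most two translates of [w (x / rho)] are nonzero at a
    point: those by the integers on both sides of [x]. *)
Definition periodized (x : R) : R := w (frac x / rho) + w ((frac x - 1) / rho).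

(** The mesh must resolve the weight at scale [rho], and its support must fit
    into one period with room for the shifts of summation by parts. *)
Definition fine_mesh (m : nat) : bool :=
  (1 <= (m.*2.+1)%:R * rho) && (2 * ((m.*2.+1)%:R * rho) + 3 <= (m.*2.+1)%:R).

Lemma sdist_small (x : R) : `|x| < 2^-1 -> sdist x = x.
Proof.
rewrite ltr_norml => /andP[x1 x2]; rewrite /sdist /nint (_ : Num.floor _ = 0) ?subr0 //.
by apply: floor_def; rewrite add0r; apply/andP; split; lra.
Qed.

Lemma coef_bound m b : fine_mesh m -> (`|b| <= m)%N ->
  normc (coef m b) <= 11 * K * rho /\
  normc (coef m b) * (rho * `|b%:~R|) ^+ 2 <= 11 * K * rho.
Proof.
move=> /andP[f1 f2] bm; set q := m.*2.+1.
have q0 : (0 : R) < q%:R by rewrite ltr0n.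
have [] := @expsum_bound R K w nw (q%:R * rho) (- (b%:~R / q%:R)) q f1 f2.
rewrite sdist_small; last first.
  rewrite normrN normrM normfV (gtr0_norm q0) ltr_pdivrMr //.
  have : `|b%:~R : R| <= m%:R by rewrite intr_norm_le_nat.
  have : (q%:R : R) = m%:R + m%:R + 1 by rewrite /q -addnn -natr1 natrD.
  lra.
have -> : q%:R * rho * `|- (b%:~R / q%:R)| = rho * `|b%:~R|.
  by rewrite normrN normrM normfV (gtr0_norm q0); field; exact: lt0r_neq0.
rewrite /coef -/q normcM normc_real (ger0_norm (_ : 0 <= q%:R^-1)) ?invr_ge0 ?(ltW q0) //.
move=> a1 a2; split.
  by rewrite ler_pdivrMl // mulrCA.
by rewrite -mulrA ler_pdivrMl // [leRHS]mulrCA.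
Qed.

(** The zeroth coefficient is a Riemann sum. *)
Lemma coef0_limit m : continuous w -> fine_mesh m ->
  normc (coef m 0 - (rho * mass w)%:C) <= 10 * K / (m.*2.+1)%:R.
Proof.
move=> cw /andP[f1 f2]; set q := m.*2.+1.
have q0 : (0 : R) < q%:R by rewrite ltr0n.
have := zsum_riemann nw cw f1 f2; rewrite -/q.
have -> : coef m 0 = (q%:R^-1 * zsum q (fun a => w (a%:~R / (q%:R * rho))))%:C.
  rewrite /coef -/q rmorphM /=; congr (_ * _).
  rewrite /expsum /zsum rmorph_sum; apply: eq_bigr => i _ /=.
  by rewrite mul0r oppr0 mulr0 cexp0 mulr1.
rewrite -rmorphB normc_real => le.
have -> : q%:R^-1 * zsum q (fun a => w (a%:~R / (q%:R * rho))) - rho * mass w =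
   q%:R^-1 * (zsum q (fun a => w (a%:~R / (q%:R * rho))) - q%:R * rho * mass w).
  by field; exact: lt0r_neq0.
by rewrite normrM ger0_norm ?invr_ge0 ?(ltW q0) // mulrC ler_pM2r // invr_gt0.
Qed.

(** The orthogonality relation leaves the nodes congruent to [l] modulo
    [2 m + 1]; within the support of the weight these are [l] and
    [l - (2 m + 1)]. *)
Lemma interp_node m (l : nat) : fine_mesh m -> (l < m.*2.+1)%N ->
  interp m (l%:R / (m.*2.+1)%:R) =
  (w (l%:R / (m.*2.+1)%:R / rho) + w ((l%:R / (m.*2.+1)%:R - 1) / rho))%:C.
Proof.
move=> /andP[f1 f2]; set q := m.*2.+1 in f1 f2 * => lq.
have q0 : (0 : R) < q%:R by rewrite ltr0n.
pose M := q%:R * rho.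
have M0 : 0 < M by rewrite mulr_gt0.
have -> : interp m (l%:R / q%:R) = zsum q (fun j => (w (j%:~R / M))%:C *
   ((q%:R^-1)%:C * zsum m (fun b => cexp_2pi (b%:~R * ((l%:Z - j)%:~R / q%:R))))).
  rewrite /interp /coef -/q /expsum -/M /zsum.
  under eq_bigr do rewrite mulr_sumr mulr_suml.
  rewrite exchange_big /=; apply: eq_bigr => j _; rewrite !mulr_sumr.
  apply: eq_bigr => b _.
  rewrite -!mulrA mulrCA -cexpD; congr (_ * (_ * cexp_2pi _)).
  by rewrite intrB; ring.
have -> : (w (l%:R / q%:R / rho) + w ((l%:R / q%:R - 1) / rho))%:C =
   zsum q (fun j => (if j == l%:Z then (w (l%:R / M))%:C else 0) +
     (if j == l%:Z - q%:Z then (w ((l%:R - q%:R) / M))%:C else 0)).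
  rewrite zsumD !zsum_pick; [|lia..].
  have e1 : l%:R / q%:R / rho = l%:R / M by rewrite /M invfM mulrA.
  have e2 : (l%:R / q%:R - 1) / rho = (l%:R - q%:R) / M.
    by rewrite /M; field; rewrite !lt0r_neq0.
  by rewrite e1 e2 rmorphD.
have qC : (q%:R^-1)%:C * q%:R = 1 :> R[i].
  by rewrite -(rmorph_nat (real_complex R) q) -rmorphM mulVf // lt0r_neq0.
apply: eq_zsum => j jq; rewrite unit_root_sum -/q.
have [->|jl] := eqVneq j l%:Z.
  rewrite subrr dvdz0 ifF ?addr0; last by apply/negP => /eqP; lia.
  by rewrite qC mulr1.
have [->|jl'] := eqVneq j (l%:Z - q%:Z).
  rewrite opprB addrCA subrr addr0 dvdzz add0r intrB.
  by rewrite qC mulr1.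
rewrite addr0; case: ifP => [/dvdzP[k kE]|]; last by rewrite !mulr0.
suff -> : w (j%:~R / M) = 0 by rewrite mul0r.
apply: (weight_out_nat nw (H := q.-1)) => //.
  have -> : (q.-1)%:R = q%:R - 1 :> R by rewrite /q -natr1 addrK.
  by move: f2; rewrite -/M; move: (q%:R : R) => y; lra.
have [k0|k0] := eqVneq k 0; first by lia.
have [k1|k1] := eqVneq k 1; first by lia.
have : (2 <= k) || (k <= -1) by lia.
case/orP => hk.
  have : (l%:Z - j >= 2 * q%:Z) by rewrite kE; apply: ler_wpM2r.
  lia.
have : (l%:Z - j <= -1 * q%:Z) by rewrite kE; apply: ler_wpM2r.
lia.
Qed.

End interpolation.

(** * Convergence of the interpolation *)

Lemma harmonic_sum_le (R : realType) (m : nat) :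
  zsum m (fun b => `|b%:~R|^-1 : R) <= 4 * Num.sqrt m%:R.
Proof.
elim: m => [|m IH].
  by rewrite /zsum big_ord_recl big_ord0 /cint /= subrr normr0 invr0 sqrtr0 addr0 mulr0.
rewrite zsumS intrN normrN normr_nat.
set s := Num.sqrt m%:R in IH; set t := Num.sqrt _.
have s0 : 0 <= s by exact: sqrtr_ge0.
have t0 : 0 <= t by exact: sqrtr_ge0.
have s2 : s ^+ 2 = m%:R by rewrite sqr_sqrtr.
have t2 : t ^+ 2 = s ^+ 2 + 1 by rewrite sqr_sqrtr // s2 natr1.
have t1 : 1 <= t by rewrite -(@ler_pXn2r _ 2) ?nnegrE // expr1n t2 lerDr sqr_ge0.
have -> : m.+1%:R = t ^+ 2 :> R by rewrite t2 s2 natr1.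
suff : 2 * (t ^+ 2)^-1 <= 4 * (t - s) by lra.
rewrite ler_pdivrMr ?exprn_gt0 //; last by lra.
have st : s <= t by rewrite -(@ler_pXn2r _ 2) ?nnegrE // t2 lerDl.
have dE : (t - s) * (t + s) = 1 by rewrite -subr_sqr t2; ring.
have : (t - s) * (t + s) <= (t - s) * (2 * t ^+ 2).
  by rewrite ler_wpM2l ?subr_ge0 //; nra.
rewrite dE; lra.
Qed.

Definition tends (R : realType) (u : nat -> R[i]) (l : R[i]) : Prop :=
  forall eps : R, 0 < eps -> exists m0, forall m, (m0 <= m)%N -> normc (u m - l) <= eps.

Section interp_limit.
Variables (R : realType) (K : R) (w : R -> R) (rho : R).
Hypothesis nw : nice_weight K w.
Hypothesis rho01 : 0 < rho < 2^-1.

Let rho0 : 0 < rho. Proof. by case/andP: rho01. Qed.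
Let K0 : 0 <= K. Proof. by case: nw => wK _ _ _; have /andP[a /(le_trans a)] := wK 0. Qed.

Lemma fine_mesh_eventually : exists m0, forall m, (m0 <= m)%N -> fine_mesh rho m.
Proof.
have r2 : 0 < 1 - 2 * rho by case/andP: rho01 => ? ?; lra.
pose B := rho^-1 + 3 / (1 - 2 * rho).
exists (Num.truncn B).+1 => m Bm.
have qB : B <= (m.*2.+1)%:R.
  apply/ltW; apply: lt_le_trans (truncnS_gt B) _.
  by rewrite ler_nat (leq_trans Bm) // leqW // -addnn leq_addr.
have i1 : 0 < rho^-1 by rewrite invr_gt0.
have i2 : 0 < 3 / (1 - 2 * rho) by rewrite divr_gt0.
rewrite /fine_mesh; apply/andP; split.
  by rewrite -ler_pdivrMr // div1r; apply: le_trans qB; rewrite /B lerDl ltW.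
have : 3 / (1 - 2 * rho) <= (m.*2.+1)%:R by apply: le_trans qB; rewrite /B lerDr ltW.
rewrite ler_pdivrMr //; lra.
Qed.

Lemma interp_frac m x : interp w rho m x = interp w rho m (frac x).
Proof.
apply: eq_bigr => b _; congr (_ * _).
by rewrite /frac mulrBr cexpD -intrM -intrN cexp_int mulr1.
Qed.

(** Compare [x] with the node to its left, where the interpolation is exact.
    The periodized weight is Lipschitz; the polynomial varies by at most the sum
    of [|coef b| |b| / (2 m + 1)], and [|coef b| |b|] is of order [1 / |b|], so
    that a harmonic sum appears.  Bounding it by a square root gives the rate
    [(2 m + 1)^(-1/2)]. *)
Lemma interp_error m x : fine_mesh rho m ->
  normc (interp w rho m x - (periodized w rho x)%:C) <=
    (88 * pi + 2) * K / rho / Num.sqrt (m.*2.+1)%:R.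
Proof.
move=> fm; rewrite interp_frac /periodized; have := frac_itv x.
move: (frac x) => {}x /andP[x0 x1].
set q := m.*2.+1; have q0 : (0 : R) < q%:R by rewrite ltr0n.
pose l := Num.truncn (q%:R * x).
have [|l1 l2] := andP (@truncn_itv R (q%:R * x) _); first by rewrite mulr_ge0 // ltW.
have lq : (l < q)%N.
  by rewrite truncn_lt_nat ?mulr_ge0 ?(ltW q0) // -[ltRHS]mulr1 ltr_pM2l.
pose y : R := l%:R / q%:R.
have xy : `|x - y| <= q%:R^-1.
  have -> : x - y = (q%:R * x - l%:R) / q%:R by rewrite /y; field; exact: lt0r_neq0.
  rewrite normrM normfV (gtr0_norm q0) ler_pdivrMr // mulVf ?lt0r_neq0 //.
  rewrite ger0_norm ?subr_ge0 // lerBlDl natr1; exact: ltW.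
have eW : normc ((w (x / rho) + w ((x - 1) / rho))%:C - (w (y / rho) + w ((y - 1) / rho))%:C)
   <= 2 * K / rho / q%:R.
  rewrite -rmorphB normc_real.
  have [_ _ lip _] := nw.
  have e1 := lip (x / rho) (y / rho); have e2 := lip ((x - 1) / rho) ((y - 1) / rho).
  have dist u : `|u / rho| = `|u| / rho by rewrite normrM normfV (gtr0_norm rho0).
  rewrite -mulrBl dist in e1; rewrite -mulrBl (_ : x - 1 - (y - 1) = x - y) ?dist in e2; last by ring.
  rewrite opprD addrACA; apply: le_trans (ler_normD _ _) _.
  have : K * (`|x - y| / rho) <= K / rho / q%:R.
    by rewrite mulrA mulrAC ler_wpM2l // divr_ge0 // ltW.
  move: e1 e2; rewrite (_ : 2 * K / rho / q%:R = K / rho / q%:R + K / rho / q%:R); last by ring.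
  move=> e1 e2 e3; apply: lerD; [apply: le_trans e1 _ | apply: le_trans e2 _] => //.
have eI : normc (interp w rho m x - interp w rho m y) <= 88 * pi * K / rho * (Num.sqrt m%:R / q%:R).
  rewrite /interp /zsum -sumrB; apply: le_trans (normc_sum _ _ _) _.
  apply: (@le_trans _ _ (\sum_(i < q) (22 * pi * K / rho / q%:R) * `|(cint i)%:~R|^-1)).
    apply: ler_sum => i _; rewrite -mulrBr normcM.
    have [_ cb] := coef_bound nw fm (cint_le i).
    have up := cexpB_upper ((cint i)%:~R * x) ((cint i)%:~R * y).
    apply: le_trans (ler_wpM2l (normc_ge0 _) up) _.
    have [b0|b0] := eqVneq (cint i) 0.
      by rewrite b0 !mul0r subrr normr0 !mulr0 invr0 mulr0.
    have ab0 : 0 < `|(cint i)%:~R| :> R by rewrite normr_gt0 intr_eq0.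
    rewrite -mulrBr normrM.
    move: cb xy; set c := normc _; set a := `|_%:~R|; set D := `|x - y|.
    rewrite -/a in ab0 => cb xy.
    have ca : c * a <= 11 * K / rho / a.
      rewrite ler_pdivlMr // ler_pdivlMr //.
      rewrite -(ler_pM2r rho0); apply: le_trans cb.
      by apply: le_of_eq; ring.
    have c0 : 0 <= c by exact: normc_ge0.
    have p0 := pi_ge0 R.
    have -> : c * (2 * pi * (a * D)) = 2 * pi * ((c * a) * D) by ring.
    have -> : 22 * pi * K / rho / q%:R / a = 2 * pi * ((11 * K / rho / a) * q%:R^-1) by ring.
    apply: ler_wpM2l; first by rewrite mulr_ge0.
    by apply: ler_pM => //; [rewrite mulr_ge0 // ltW | exact: normr_ge0].
  rewrite -mulr_sumr.
  have := harmonic_sum_le R m; rewrite /zsum -/q => har.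
  apply: le_trans (ler_wpM2l _ har) _.
    by rewrite !divr_ge0 ?mulr_ge0 ?pi_ge0 ?(ltW q0) ?(ltW rho0).
  by apply: le_of_eq; ring.
have nodeE := interp_node nw rho01 fm lq; rewrite -/q -/y in nodeE.
set F := (w (x / rho) + _)%:C in eW *; rewrite -nodeE in eW.
have -> : interp w rho m x - F = interp w rho m x - interp w rho m y
   - (F - interp w rho m y) by ring.
apply: le_trans (normcD _ _) _; rewrite normc_opp.
set s := Num.sqrt (q%:R : R).
have s1 : 1 <= s by rewrite -[1]sqrtr1 ler_sqrt // ler1n.
have s2 : q%:R = s ^+ 2 by rewrite sqr_sqrtr // ltW.
have ms : Num.sqrt m%:R <= s by rewrite ler_sqrt // ler_nat /q leqW // -addnn leq_addr.
have s0 : 0 < s by lra.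
have a1 : Num.sqrt m%:R / q%:R <= s^-1.
  rewrite s2 ler_pdivrMr ?exprn_gt0 // expr2 mulKf ?lt0r_neq0 //.
have a2 : q%:R^-1 <= s^-1.
  by rewrite s2 lef_pV2 ?posrE ?exprn_gt0 // expr2 ler_peMl // ltW.
have KR : 0 <= K / rho by rewrite divr_ge0 // ltW.
have p0 := pi_ge0 R.
have -> : (88 * pi + 2) * K / rho / s = 88 * pi * K / rho * s^-1 + 2 * K / rho * s^-1 by ring.
apply: lerD; [apply: le_trans eI _ | apply: le_trans eW _]; apply: ler_wpM2l => //.
  by rewrite -mulrA mulr_ge0 // mulr_ge0.
by rewrite -mulrA mulr_ge0.
Qed.

Lemma interp_tends x : tends (fun m => interp w rho m x) (periodized w rho x)%:C.
Proof.
move=> eps eps0; have [m0 fm] := fine_mesh_eventually.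
set C := (88 * pi + 2) * K / rho.
have C0 : 0 <= C.
  by rewrite divr_ge0 ?(ltW rho0) // mulr_ge0 // addr_ge0 // mulr_ge0 // pi_ge0.
exists (maxn m0 (Num.truncn ((C / eps) ^+ 2)).+1) => m; rewrite geq_max => /andP[m0m Cm].
apply: le_trans (interp_error x (fm m m0m)) _; rewrite -/C.
have qC : (C / eps) ^+ 2 <= (m.*2.+1)%:R.
  apply/ltW; apply: lt_le_trans (truncnS_gt _) _.
  by rewrite ler_nat (leq_trans Cm) // leqW // -addnn leq_addr.
have s0 : 0 < Num.sqrt (m.*2.+1)%:R :> R by rewrite sqrtr_gt0 ltr0n.
rewrite ler_pdivrMr // mulrC -ler_pdivrMr //.
have Ce0 : 0 <= C / eps by rewrite divr_ge0 // ltW.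
by rewrite -(ger0_norm Ce0) -sqrtr_sqr ler_sqrt.
Qed.

Lemma zsum_periodized (H : nat) (x : R) : `|x| + 2 <= H%:R ->
  zsum H (fun a => w ((a%:~R + x) / rho)) = periodized w rho x.
Proof.
move=> xH; have [_ wz _ _] := nw.
have /andP[f0 f1] := frac_itv x; set f := frac x in f0 f1.
pose k := Num.floor x; have xE : x = f + k%:~R by rewrite /f /frac subrK.
have kH : (`|(- k)%R| <= H.-1)%N.
  rewrite -(intr_norm_le_nat R) intrN normrN.
  have -> : (k%:~R : R) = x - f by rewrite xE; ring.
  have H1 : (H.-1)%:R = H%:R - 1 :> R.
    rewrite -subn1 natrB // -(ltr_nat R).
    by have := normr_ge0 x; lra.
  rewrite H1; apply: le_trans (ler_normB _ _) _; rewrite (ger0_norm f0); lra.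
have H0 : (0 < H)%N by rewrite -(ltr_nat R); have := normr_ge0 x; lra.
transitivity (zsum H (fun j => (if j == - k then w (f / rho) else 0) +
   (if j == - k - 1 then w ((f - 1) / rho) else 0))); last first.
  by rewrite zsumD !zsum_pick //; lia.
apply: eq_zsum => a _; have [->|ak] := eqVneq a (- k).
  rewrite ifF ?addr0; last by apply/negP => /eqP; lia.
  by rewrite intrN xE addrCA addNr addr0.
have [->|ak'] := eqVneq a (- k - 1).
  by rewrite add0r xE; congr (w (_ / _)); rewrite intrB intrN; ring.
rewrite addr0; apply: wz; rewrite normrM normfV (gtr0_norm rho0) ltr_pdivlMr //.
have r2 : 2 * rho < 1 by case/andP: rho01 => ? ?; lra.
apply: lt_le_trans r2 _; rewrite xE (addrC f) addrA -intrD.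
have : (1 <= a + k) || (a + k <= - 2) by lia.
case/orP => h.
  have : (1 : R) <= (a + k)%:~R by rewrite -[1]/(1%:~R) ler_int.
  by move=> ?; rewrite ler_normr; apply/orP; left; lra.
have : ((a + k)%:~R : R) <= (- 2)%:~R by rewrite ler_int.
rewrite intrN => ?; rewrite ler_normr; apply/orP; right; lra.
Qed.

End interp_limit.

(** * Uniform bound for the discrepancy *)

Section tends.
Variable R : realType.
Implicit Types (u v : nat -> R[i]) (l : R[i]).

Lemma tends_cst l : tends (fun=> l) l.
Proof. by move=> eps eps0; exists 0 => m _; rewrite subrr normc0 ltW. Qed.

Lemma tendsD u v l l' : tends u l -> tends v l' -> tends (fun m => u m + v m) (l + l').
Proof.
move=> ul vl eps eps0; have e2 : 0 < eps / 2 by rewrite divr_gt0.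
have [m1 h1] := ul _ e2; have [m2 h2] := vl _ e2.
exists (maxn m1 m2) => m; rewrite geq_max => /andP[/h1 a1 /h2 a2].
rewrite opprD addrACA; apply: le_trans (normcD _ _) _; lra.
Qed.

Lemma tendsM u v l l' : tends u l -> tends v l' -> tends (fun m => u m * v m) (l * l').
Proof.
move=> ul vl eps eps0.
have l0 := normc_ge0 l; have l'0 := normc_ge0 l'.
have e1 : 0 < eps / 2 / (normc l' + 1) by rewrite !divr_gt0 //; lra.
have e2 : 0 < eps / 2 / (normc l + 1) by rewrite !divr_gt0 //; lra.
have [m1 h1] := ul _ ltr01; have [m2 h2] := ul _ e1; have [m3 h3] := vl _ e2.
exists (maxn m1 (maxn m2 m3)) => m; rewrite !geq_max => /and3P[/h1 a1 /h2 a2 /h3 a3].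
have -> : u m * v m - l * l' = u m * (v m - l') + l' * (u m - l) by ring.
apply: le_trans (normcD _ _) _; rewrite !normcM.
have ub : normc (u m) <= normc l + 1.
  have -> : u m = l + (u m - l) by ring.
  by apply: le_trans (normcD _ _) _; rewrite lerD2l.
have b1 : normc (u m) * normc (v m - l') <= eps / 2.
  apply: (@le_trans _ _ ((normc l + 1) * (eps / 2 / (normc l + 1)))).
    by rewrite ler_pM ?normc_ge0.
  by rewrite mulrC divfK //; apply: lt0r_neq0; lra.
have b2 : normc l' * normc (u m - l) <= eps / 2.
  apply: (@le_trans _ _ ((normc l' + 1) * (eps / 2 / (normc l' + 1)))).
    by rewrite ler_pM ?normc_ge0 // lerDl.
  by rewrite mulrC divfK //; apply: lt0r_neq0; lra.
lra.
Qed.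

Lemma tends_sum (I : Type) (s : seq I) (P : pred I) (F : I -> nat -> R[i]) (G : I -> R[i]) :
  (forall i, P i -> tends (F i) (G i)) ->
  tends (fun m => \sum_(i <- s | P i) F i m) (\sum_(i <- s | P i) G i).
Proof.
move=> FG; elim: s => [|i s IH].
  by rewrite big_nil; under eq_fun do rewrite big_nil; exact: tends_cst.
rewrite big_cons; under eq_fun do rewrite big_cons.
by case: ifP => // Pi; apply: tendsD => //; exact: FG.
Qed.

Lemma tends_prod (I : Type) (s : seq I) (P : pred I) (F : I -> nat -> R[i]) (G : I -> R[i]) :
  (forall i, P i -> tends (F i) (G i)) ->
  tends (fun m => \prod_(i <- s | P i) F i m) (\prod_(i <- s | P i) G i).
Proof.
move=> FG; elim: s => [|i s IH].
  by rewrite big_nil; under eq_fun do rewrite big_nil; exact: tends_cst.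
rewrite big_cons; under eq_fun do rewrite big_cons.
by case: ifP => // Pi; apply: tendsM => //; exact: FG.
Qed.

Lemma tends_bound u l (C : R) m0 :
  tends u l -> (forall m, (m0 <= m)%N -> normc (u m) <= C) -> normc l <= C.
Proof.
move=> ul uC; rewrite leNgt; apply/negP => Cl.
have e0 : 0 < (normc l - C) / 2 by rewrite divr_gt0 // subr_gt0.
have [m1 h] := ul _ e0.
have a1 := h (maxn m0 m1) (leq_maxr _ _); have a2 := uC (maxn m0 m1) (leq_maxl _ _).
have : normc l <= normc (u (maxn m0 m1)) + normc (u (maxn m0 m1) - l).
  rewrite -[X in _ + X]normc_opp opprB; apply: le_trans (normcD _ _).
  by rewrite addrC subrK.
lra.
Qed.

End tends.

Section upper_bound.
Variables (R : realType) (d : nat) (K c : R) (w : 'I_d -> R -> R) (wk : R -> R).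
Variables (al : 'I_d -> R).
Hypothesis K0 : 0 < K.
Hypothesis nw : forall i, nice_weight K (w i).
Hypothesis cw : forall i, continuous (w i).
Hypothesis nwk : nice_weight K wk.
Hypothesis cwk : continuous wk.
Hypothesis c0 : 0 < c.
Hypothesis dual : dual_bad c al.
Variables (N H : nat) (gam rho : 'I_d -> R).
Hypothesis N0 : (0 < N)%N.
Hypothesis NH : 2 * N%:R + 3 <= H%:R :> R.
Hypothesis rho01 : forall i, 0 < rho i < 2^-1.

(** The smooth count with the sums over the first [d] coordinates carried
    out. *)
Definition periodic_count : R := zsum H (fun n => wk (n%:~R / N%:R) *
  \prod_i periodized (w i) (rho i) (n%:~R * al i - gam i)).

Let approx m : R[i] := zsum H (fun n => (wk (n%:~R / N%:R))%:C *
  \prod_i interp (w i) (rho i) m (n%:~R * al i - gam i)).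

Let approx_tends : tends approx periodic_count%:C.
Proof.
rewrite /periodic_count /zsum rmorph_sum; apply: tends_sum => n _.
rewrite rmorphM rmorph_prod; apply: tendsM; first exact: tends_cst.
by apply: tends_prod => i _; apply: interp_tends.
Qed.

Let term m (b : {ffun 'I_d -> 'I_m.*2.+1}) : R[i] :=
  (\prod_i (coef (w i) (rho i) m (cint (b i)) * cexp_2pi (- ((cint (b i))%:~R * gam i)))) *
  expsum wk N%:R (linform al b) H.

Let approxE m : approx m = \sum_b @term m b.
Proof.
rewrite /approx /zsum.
under eq_bigr do rewrite /interp /zsum bigA_distr_bigA mulr_sumr /=.
rewrite exchange_big /=; apply: eq_bigr => b _.
rewrite /term /expsum /zsum mulr_sumr; apply: eq_bigr => n _.
rewrite mulrCA; congr (_ * _).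
rewrite /linform mulr_sumr cexp_sum -big_split /=; apply: eq_bigr => i _.
by rewrite -[RHS]mulrA -cexpD; congr (_ * cexp_2pi _); ring.
Qed.

Let N1 : 1 <= N%:R :> R. Proof. by rewrite ler1n. Qed.

Let S0 : R := zsum H (fun n => wk (n%:~R / N%:R)).

Let main m : R[i] := (\prod_i coef (w i) (rho i) m 0) * S0%:C.

Let main_tends : tends main ((\prod_i (rho i * mass (w i))) * S0)%:C.
Proof.
rewrite rmorphM; apply: tendsM; last exact: tends_cst.
rewrite rmorph_prod; apply: tends_prod => i _ eps eps0.
have [m0 fm] := fine_mesh_eventually (rho01 i).
exists (maxn m0 (Num.truncn (10 * K / eps)).+1) => m; rewrite geq_max => /andP[m0m Km].
apply: le_trans (coef0_limit (nw i) (@cw i) (fm m m0m)) _.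
rewrite ler_pdivrMr ?ltr0n // -ler_pdivrMl // mulrC.
apply: ltW; apply: lt_le_trans (truncnS_gt _) _.
by rewrite ler_nat (leq_trans Km) // leqW // -addnn leq_addr.
Qed.

Let zb m : {ffun 'I_d -> 'I_m.*2.+1} := [ffun=> inord m].

Let cint_zb m i : cint (zb m i) = 0.
Proof. by rewrite ffunE /cint inordK ?subrr // ltnS -addnn leq_addr. Qed.

Let nonzeroP m (b : {ffun 'I_d -> 'I_m.*2.+1}) :
  [exists i, cint (b i) != 0] = (b != zb m).
Proof.
apply/idP/idP => [/existsP[j]|].
  by apply: contra => /eqP ->; rewrite cint_zb.
apply: contraR => /existsPn h; apply/eqP/ffunP => i; apply: (@cint_inj m).
by rewrite cint_zb; apply/eqP; have := h i; rewrite negbK.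
Qed.

Let term0 m : @term m (zb m) = main m.
Proof.
rewrite /term /main; congr (_ * _).
  by apply: eq_bigr => i _; rewrite cint_zb mul0r oppr0 cexp0 mulr1.
rewrite /expsum /S0 /zsum rmorph_sum; apply: eq_bigr => n _.
rewrite (_ : linform al (zb m) = 0) ?mulr0 ?cexp0 ?mulr1 //.
by apply: big1 => i _; rewrite cint_zb mul0r.
Qed.

Let two_pow_gt (n : nat) : n%:R < 2 ^+ n :> R.
Proof. by rewrite -natrX ltr_nat ltn_expl. Qed.

Definition dual_const : R := 11 * K * (11 * K) ^+ d * (16 * 16 ^+ d) / c.

(** All nonzero frequencies together.  The factor [N rho_1 ... rho_d] coming
    from the coefficients cancels the denominator of [dual_sum_bound]. *)
Let tail_bound m : (forall i, fine_mesh (rho i) m) ->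
  normc (approx m - main m) <= dual_const.
Proof.
move=> fm; rewrite approxE (bigD1 (zb m)) //= term0 addrAC subrr add0r.
apply: le_trans (normc_sum _ _ _) _.
rewrite -(eq_bigl _ _ (@nonzeroP m)).
(* Any exponent beyond the largest argument of [decay] will do. *)
pose U := (m + N)%N.
have rho0 i : 0 < rho i by case/andP: (rho01 i).
have NR0 : 0 < N%:R :> R by rewrite ltr0n.
have P0 : 0 < \prod_i rho i by exact: prodr_gt0.
apply: (@le_trans _ _ (\sum_(b : {ffun 'I_d -> 'I_m.*2.+1} | [exists i, cint (b i) != 0])
   (11 * K * N%:R * \prod_i (11 * K * rho i)) *
   ((\prod_i decay U.+1 (rho i * `|(cint (b i))%:~R|)) *
        decay U.+1 (N%:R * `|sdist (linform al b)|)))).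
  apply: ler_sum => b _; rewrite /term normcM normc_prod.
  rewrite [leRHS](_ : _ = (\prod_i (11 * K * rho i * decay U.+1 (rho i * `|(cint (b i))%:~R|)))
     * (11 * K * N%:R * decay U.+1 (N%:R * `|sdist (linform al b)|))); last first.
    by rewrite [in RHS]big_split /=; ring.
  apply: ler_pM; [by apply: prodr_ge0 => i _; exact: normc_ge0 | exact: normc_ge0 | | ].
    apply: ler_prod => i _; rewrite normc_ge0 /= normcM normc_cexp mulr1.
    have [a1 a2] := coef_bound (nw i) (fm i) (cint_le (b i)).
    apply: le_decay => //; first by rewrite !mulr_ge0 // ltW.
    apply: le_lt_trans (two_pow_gt _).
    have : `|(cint (b i))%:~R : R| <= m%:R by rewrite intr_norm_le_nat cint_le.
    have /andP[r0 r2] := rho01 i.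
    rewrite /U natrD; have := normr_ge0 ((cint (b i))%:~R : R); move: NR0.
    set a := `|_|; move: (N%:R : R) => n ? ? ?; nra.
  have [a1 a2] := expsum_bound nwk (linform al b) N1 NH.
  apply: le_decay => //; first by rewrite !mulr_ge0 // ltW.
  apply: le_lt_trans (two_pow_gt _).
  have := sdist_le (linform al b); have m0 : 0 <= m%:R :> R by exact: ler0n.
  rewrite /U natrD; set a := `|_|; move: NR0 m0; move: (N%:R : R) (m%:R : R) => n mm; nra.
rewrite -mulr_sumr.
have rho1 i : 0 < rho i <= 1 by have /andP[-> ?] := rho01 i; rewrite /=; lra.
apply: le_trans (ler_wpM2l _ (dual_sum_bound m U.+1 c0 dual rho1 NR0)) _.
  by apply: mulr_ge0; [rewrite !mulr_ge0 // ltW | apply: prodr_ge0 => i _; rewrite !mulr_ge0 // ltW].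
rewrite big_split /= prodr_const card_ord le_eqVlt; apply/orP; left; apply/eqP.
by rewrite /dual_const; field; rewrite !lt0r_neq0.
Qed.

(** The bound for the nonzero frequencies survives the limit of fine meshes;
    the zero frequency becomes a Riemann sum in the last variable, which
    differs from the volume by a bounded amount as the radii are below [1]. *)
Lemma periodic_count_bound :
  `|periodic_count - (\prod_i (rho i * mass (w i))) * (N%:R * mass wk)| <=
    dual_const + 10 * K * \prod_i `|mass (w i)|.
Proof.
have [m0 fm] : exists m0, forall m, (m0 <= m)%N -> forall i, fine_mesh (rho i) m.
  have [f fP] := choice (fun i => fine_mesh_eventually (rho01 i)).
  exists (\max_i f i) => m fm i; apply: fP; apply: leq_trans fm.
  exact: leq_bigmax.
have lim := tendsD approx_tends (tendsM (tends_cst (-1)) main_tends).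
have := tends_bound (m0 := m0) (C := dual_const) lim; rewrite mulN1r -rmorphB normc_real.
move=> /(_ _) bound.
have {bound} : `|periodic_count - \prod_i (rho i * mass (w i)) * S0| <= dual_const.
  by apply: bound => m m0m; rewrite mulN1r; apply: tail_bound => i; exact: fm.
have : `|\prod_i (rho i * mass (w i)) * S0 - \prod_i (rho i * mass (w i)) * (N%:R * mass wk)|
    <= 10 * K * \prod_i `|mass (w i)|.
  rewrite -mulrBr normrM mulrC; apply: ler_pM => //.
    exact: zsum_riemann.
  rewrite normr_prod; apply: ler_prod => i _; rewrite normr_ge0 normrM /=.
  by rewrite ler_piMl // ger0_norm; have /andP[? ?] := rho01 i; lra.
move=> b1 b2; rewrite -[X in `|X|](subrKA (\prod_i (rho i * mass (w i)) * S0)).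
by apply: le_trans (ler_normD _ _) _; exact: lerD.
Qed.

End upper_bound.

(** * The count as a finite sum *)

Lemma esum_finite_support (R : realType) (I : finType) (T : choiceType) (phi : I -> T)
    (g : T -> R) :
  injective phi -> (forall t, 0 <= g t) ->
  (forall t, g t != 0 -> exists i, phi i = t) ->
  \esum_(t in [set: T]) (g t)%:E = (\sum_i g (phi i))%:E.
Proof.
move=> phi_inj g0 supp; pose r := [seq phi i | i <- enum I].
have gr : forall t, t \notin r -> g t = 0.
  move=> t; apply: contraNeq => /supp[i <-]; apply: map_f; exact: mem_enum.
rewrite -sumEFin -big_enum -(big_map phi xpredT (fun t => (g t)%:E)) /=.
rewrite fsbig_seq ?(map_inj_uniq phi_inj) ?enum_uniq //.
rewrite -esum_fset; last 2 first.
- exact: finite_seq.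
- by move=> t _; rewrite lee_fin.
rewrite [RHS]esum_mkcond; apply: eq_esum => t _.
case: ifPn => // /negP tr; rewrite gr //; apply/negP => h; apply: tr.
by rewrite inE.
Qed.

Lemma nice_weight_ge0 (R : realType) (K : R) (w : R -> R) x : nice_weight K w -> 0 <= w x.
Proof. by case=> wK _ _ _; case/andP: (wK x). Qed.

(** The integer vector whose last coordinate is [p.1]: separating this coordinate
    lets the sums over the others factor. *)
Definition pair_row (d H : nat) (p : 'I_H.*2.+1 * {ffun 'I_d -> 'I_H.*2.+1}) :
    'rV[int]_d.+1 :=
  \row_j (if unlift ord_max j is Some k then cint (p.2 k) else cint p.1).

Lemma widen_lift d (k : 'I_d) : widen_ord (leqnSn d) k = lift ord_max k.
Proof. by apply: val_inj; rewrite /= /bump leqNgt ltn_ord. Qed.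

Lemma pair_row_max d H p : @pair_row d H p 0 ord_max = cint p.1.
Proof. by rewrite mxE unlift_none. Qed.

Lemma pair_row_widen d H p k :
  @pair_row d H p 0 (widen_ord (leqnSn d) k) = cint (p.2 k).
Proof. by rewrite mxE widen_lift liftK. Qed.

Lemma pair_row_inj d H : injective (@pair_row d H).
Proof.
move=> [n f] [n' f'] /rowP e; congr pair.
  by have := e ord_max; rewrite !pair_row_max => /cint_inj.
apply/ffunP => k; have := e (widen_ord (leqnSn d) k).
by rewrite !pair_row_widen => /cint_inj.
Qed.

Lemma cint_surj H (a : int) : (`|a| <= H)%N -> exists n : 'I_H.*2.+1, cint n = a.
Proof.
move=> aH; have lt : (`|(a + H%:Z)%R| < H.*2.+1)%N by lia.
by exists (Ordinal lt); rewrite /cint /=; lia.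
Qed.

Lemma pair_row_surj d H (a : 'rV[int]_d.+1) :
  (forall j, `|a 0%R j| <= H)%N -> exists p, @pair_row d H p = a.
Proof.
move=> aH; have [n nE] := cint_surj (aH ord_max).
have [f fE] := choice (fun k => cint_surj (aH (widen_ord (leqnSn d) k))).
exists (n, [ffun k => f k]); apply/rowP => j; have [k ->|->] := unliftP ord_max j.
  by rewrite -widen_lift pair_row_widen ffunE fE.
by rewrite pair_row_max nE.
Qed.

(** Once the last coordinate is within the support of its weight, the others are
    confined to a range depending on [N], [alpha] and the box, so one large [H]
    serves for all coordinates. *)
Lemma box_countE (R : realType) (d : nat) (K : R) (omega : 'I_d.+1 -> R -> R)
    (alpha : 'rV[R]_d) (B : 'rV[R]_d * 'rV[R]_d) (N : nat) :
  (forall j, nice_weight K (omega j)) -> boxes R d B -> (0 < N)%N ->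
  exists2 H : nat, 2 * N%:R + 3 <= H%:R :> R &
    box_count omega alpha B N =
    (periodic_count (fun k => omega (widen_ord (leqnSn d) k)) (omega ord_max)
       (fun k => alpha 0 k) N H (fun k => B.1 0 k) (fun k => B.2 0 k))%:E.
Proof.
move=> nw box N0; have NR0 : 0 < N%:R :> R by rewrite ltr0n.
pose w k := omega (widen_ord (leqnSn d) k).
pose sh (n : int) k : R := n%:~R * alpha 0 k - B.1 0 k.
pose Y : R := \sum_k (2 * N%:R * `|alpha 0 k| + `|B.1 0 k|).
have Y0 : 0 <= Y by apply: sumr_ge0 => k _; rewrite addr_ge0 // mulr_ge0 // mulr_ge0.
pose H := (Num.truncn (Y + (2 * N%:R + 3))).+1.
have YH : Y + (2 * N%:R + 3) < H%:R by exact: truncnS_gt.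
have shH (n : int) k : `|n%:~R : R| <= 2 * N%:R -> `|sh n k| + 2 <= H%:R.
  move=> nN; have : `|sh n k| <= Y; last by lra.
  apply: le_trans (ler_normB _ _) _; rewrite /Y (bigD1 k) //= normrM.
  rewrite ler_wpDr ?lerD2r ?ler_wpM2r //.
  by apply: sumr_ge0 => k' _; rewrite addr_ge0 // mulr_ge0 // mulr_ge0.
have rho0 k : 0 < B.2 0 k by case/andP: (box k).
exists H; first by lra.
rewrite /box_count (@esum_finite_support _ _ _ (@pair_row d H)) //.
- congr EFin; rewrite /periodic_count /zsum -/w.
  transitivity (\sum_(n < H.*2.+1) \sum_(f : {ffun 'I_d -> 'I_H.*2.+1})
      omega ord_max ((cint n)%:~R / N%:R) *
      \prod_k w k (((cint (f k))%:~R + sh (cint n) k) / B.2 0 k)).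
    rewrite pair_bigA /=; apply: eq_bigr => -[n f] _ /=.
    rewrite pair_row_max; congr (_ * _); apply: eq_bigr => k _.
    by rewrite pair_row_widen /sh addrA.
  apply: eq_bigr => n _; rewrite -mulr_sumr.
  have [nN|nN] := leP `|(cint n)%:~R : R| (2 * N%:R); last first.
    by rewrite (weight_out (nw _)) // !mul0r.
  congr (_ * _).
  rewrite -(bigA_distr_bigA (fun k (a : 'I_H.*2.+1) => w k (((cint a)%:~R + sh (cint n) k) / B.2 0 k))).
  apply: eq_bigr => k _; exact: (zsum_periodized (nw _) (box k) (shH _ _ nN)).
- exact: pair_row_inj.
- move=> a; apply: mulr_ge0; first exact: nice_weight_ge0.
  by apply: prodr_ge0 => k _; exact: nice_weight_ge0.
move=> a ga; apply: pair_row_surj.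
have aN : `|(a 0 ord_max)%:~R : R| <= 2 * N%:R.
  rewrite leNgt; apply/negP => aN; move/negP: ga; apply.
  by rewrite (weight_out (nw _)) // mul0r.
move=> j; rewrite -(intr_norm_le_nat R); have [k ->|->] := unliftP ord_max j; last by lra.
rewrite leNgt; apply/negP => aH; move/negP: ga; apply; rewrite -widen_lift in aH.
rewrite (bigD1 k) //= (_ : omega (widen_ord (leqnSn d) k) _ = 0) ?mul0r ?mulr0 //.
case: (nw (widen_ord (leqnSn d) k)) => _ wz _ _; apply: wz.
rewrite normrM normfV (gtr0_norm (rho0 k)) ltr_pdivlMr //.
have /andP[_ r2] := box k; apply: (@lt_trans _ _ 2); first by lra.
have := shH _ k aN; rewrite -addrA -/(sh _ _) => s2.
have := ler_normB ((a 0 (widen_ord (leqnSn d) k))%:~R + sh (a 0 ord_max) k) (sh (a 0 ord_max) k).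
rewrite addrK; lra.
Qed.

(** * Unbounded discrepancy implies the Littlewood conjecture *)

Lemma limn_einf_eq0P (R : realType) (u : nat -> R) : (forall n, 0 <= u n) ->
  limn_einf (fun n => (u n)%:E) = 0%E <->
  (forall (eps : R) (n0 : nat), 0 < eps -> exists2 n, (n0 <= n)%N & u n < eps).
Proof.
move=> u0; pose v n := (u n)%:E.
have lim : limn_einf v = ereal_sup (range (einfs v)).
  by rewrite limn_einf_lim; apply/cvg_lim => //; exact: cvg_einfs_sup.
have le0 n : (0 <= einfs v n)%E.
  by apply: le_ereal_inf_tmp => _ [p _ <-]; rewrite lee_fin.
rewrite -/v lim; split => [sup0 eps n0 eps0|H].
  apply: contrapT => /forall2NP nu.
  have : (eps%:E <= 0 :> \bar R)%E; last by rewrite lee_fin leNgt eps0.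
  rewrite -sup0; apply: (@le_trans _ _ (einfs v n0)); last first.
    by apply: ereal_sup_ubound; exists n0.
  apply: le_ereal_inf_tmp => _ [p /= n0p <-]; rewrite lee_fin leNgt.
  by apply/negP => pe; case: (nu p).
apply/eqP; rewrite eq_le; apply/andP; split; last first.
  by apply: le_trans (le0 0%N) _; apply: ereal_sup_ubound; exists 0%N.
apply: ge_ereal_sup => _ [n _ <-].
apply/lee_addgt0Pr => eps eps0; rewrite add0e.
have [p np pe] := H eps n eps0.
apply: (@le_trans _ _ (v p)); last by rewrite lee_fin ltW.
by apply: ereal_inf_lbound; exists p.
Qed.

Section dist_int.
Variable R : realType.
Implicit Types x : R.

Lemma dist_int_ge0 x : 0 <= dist_int x.
Proof.
apply: lb_le_inf; first by exists `|x - 0%:~R|, 0.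
by move=> _ [a _ <-].
Qed.

Lemma dist_int_le x (a : int) : dist_int x <= `|x - a%:~R|.
Proof.
apply: ge_inf; last by exists a.
by exists 0 => _ [b _ <-].
Qed.

Lemma dist_int_approx x (tau : R) : 0 < tau ->
  exists a : int, `|x - a%:~R| <= dist_int x + tau.
Proof.
move=> tau0; have hi : has_inf [set `|x - a%:~R| | a in [set: int]].
  split; first by exists `|x - 0%:~R|, 0.
  by exists 0 => _ [b _ <-].
have [_ [a _ <-] lt] := inf_adherent tau0 hi.
by exists a; exact: ltW.
Qed.

End dist_int.

(** A positive liminf bounds the products from some [n0] on.  Any [n] has the
    multiple [n * n0.+1] in that range, and passing to it multiplies each
    distance by at most [n0.+1]. *)
Lemma not_littlewood_simul_bad (R : realType) (d : nat) (alpha : 'rV[R]_d) :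
  limn_einf (fun n : nat =>
      (n%:R * \prod_(i < d) dist_int (n%:R * alpha 0 i))%:E) <> 0%E ->
  exists2 c : R, 0 < c & simul_bad c (fun k => alpha 0 k).
Proof.
move=> nlim; pose u (n : nat) : R := n%:R * \prod_(i < d) dist_int (n%:R * alpha 0 i).
have u0 n : 0 <= u n.
  by apply: mulr_ge0 => //; apply: prodr_ge0 => i _; exact: dist_int_ge0.
have [eps [n0 [eps0 lb]]] : exists eps n0, 0 < eps /\ forall n, (n0 <= n)%N -> eps <= u n.
  apply: contrapT => H; apply: nlim; apply/(limn_einf_eq0P u0) => eps n0 eps0.
  apply: contrapT => /forall2NP nu; apply: H; exists eps, n0; split => // n n0n.
  by rewrite leNgt; apply/negP => ?; case: (nu n).
pose L := n0.+1; have L0 : (0 : R) < L%:R by rewrite ltr0n.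
exists (eps / (L%:R * L%:R ^+ d)); first by rewrite divr_gt0 // mulr_gt0 // exprn_gt0.
move=> n n1 a; rewrite ler_pdivrMr ?mulr_gt0 ?exprn_gt0 //.
have nL : (n0 <= n * L)%N by rewrite (leq_trans (leqnSn n0)) // leq_pmull.
apply: le_trans (lb _ nL) _; rewrite /u natrM -!mulrA ler_wpM2l // mulrCA ler_wpM2l //.
have -> : L%:R ^+ d = \prod_(i < d) L%:R :> R by rewrite prodr_const card_ord.
rewrite -big_split /=; apply: ler_prod => i _; rewrite dist_int_ge0 /=.
apply: le_trans (dist_int_le _ (a i * L%:Z)) _.
by rewrite intrM mulrAC -mulrBl normrM normr_nat.
Qed.

Lemma weight_constE (R : realType) (d : nat) (omega : 'I_d.+1 -> R -> R) :
  weight_const omega =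
  (\prod_(k < d) mass (omega (widen_ord (leqnSn d) k))) * mass (omega ord_max).
Proof.
rewrite /weight_const big_ord_recr Re_fourier0; congr (_ * _).
by apply: eq_bigr => k _; rewrite Re_fourier0.
Qed.

Lemma discrepancy_bounded (R : realType) (d : nat) (omega : 'I_d.+1 -> R -> R)
    (alpha : 'rV[R]_d) (c : R) :
  weight_class 3 omega -> 0 < c -> simul_bad c (fun k => alpha 0 k) ->
  exists C : R, forall N B, (0 < N)%N -> boxes R d B ->
    (`|box_discrepancy omega alpha B N| <= C%:E)%E.
Proof.
move=> /weight_class_nice[K K0 W] c0 bad.
have [c' c'0 dual] := simul_bad_dual_bad c0 bad.
have nw j : nice_weight K (omega j) by case: (W j).
have cw j : continuous (omega j) by case: (W j).
exists (dual_const d K c' + 10 * K * \prod_(k < d) `|mass (omega (widen_ord (leqnSn d) k))|).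
move=> N B N0 box; have [H NH cE] := box_countE alpha nw box N0.
rewrite /box_discrepancy cE -EFinB abse_EFin lee_fin.
have -> : weight_const omega * box_vol B N = (\prod_(k < d)
    (B.2 0 k * mass (omega (widen_ord (leqnSn d) k)))) * (N%:R * mass (omega ord_max)).
  by rewrite weight_constE /box_vol big_split /=; ring.
have bound := periodic_count_bound K0 (fun k => nw (widen_ord (leqnSn d) k))
  (fun k => cw _) (nw ord_max) (cw _) c'0 dual (fun k => B.1 0 k) N0 NH box.
exact: bound.
Qed.

Lemma unbounded_implies_littlewood (R : realType) (d : nat) (omega : 'I_d.+1 -> R -> R) :
  weight_class 3 omega -> unbounded_smooth_discrepancy omega -> littlewood R d.
Proof.
move=> W unb alpha; apply: contrapT => /not_littlewood_simul_bad[c c0 bad].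
have [C CP] := discrepancy_bounded W c0 bad.
have : (+oo <= C%:E :> \bar R)%E; last by rewrite leye_eq.
rewrite -(unb alpha); apply: ge_ereal_sup => _ [N N0 <-].
by apply: ge_ereal_sup => _ [B box <-]; exact: CP.
Qed.

(** * The Littlewood conjecture implies unbounded discrepancy *)

Lemma esum_ge_finite (R : realType) (I : finType) (T : choiceType) (phi : I -> T)
    (g : T -> R) :
  injective phi -> (forall t, 0 <= g t) ->
  ((\sum_i g (phi i))%:E <= \esum_(t in [set: T]) (g t)%:E)%E.
Proof.
move=> phi_inj g0; pose r := [seq phi i | i <- enum I].
rewrite -sumEFin -big_enum -(big_map phi xpredT (fun t => (g t)%:E)) /=.
rewrite fsbig_seq ?(map_inj_uniq phi_inj) ?enum_uniq //.
by apply: esum_ge; exists [set` r].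
Qed.

Lemma positive_lower_bound (R : realType) (I : finType) (v : I -> R) :
  (forall j, 0 < v j) -> exists2 kap : R, 0 < kap & forall j, kap <= v j.
Proof.
move=> v0; pose s := \sum_j (v j)^-1.
have s0 : 0 <= s by apply: sumr_ge0 => j _; rewrite invr_ge0 ltW.
exists (s + 1)^-1 => [|j]; first by rewrite invr_gt0; lra.
rewrite -[leRHS]invrK lef_pV2 ?posrE ?invr_gt0 //; last by lra.
rewrite /s (bigD1 j) //= -addrA lerDl addr_ge0 // sumr_ge0 // => k _.
by rewrite invr_ge0 ltW.
Qed.

(** Needed to replace the distances [dist_int], which may vanish, by positive
    radii without losing the smallness of their product. *)
Lemma prod_perturb (R : realType) (d : nat) (x : 'I_d -> R) (tau : R) :
  0 <= tau -> (forall k, 0 <= x k /\ x k + tau <= 1) ->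
  \prod_k (x k + tau) <= \prod_k x k + d%:R * tau.
Proof.
move=> tau0; elim: d x => [|d IH] x x01; first by rewrite !big_ord0 mul0r addr0.
rewrite !big_ord_recl -natr1.
have := IH (fun k => x (lift ord0 k)) (fun k => x01 _).
set P := \prod_(k < d) x _; set Q := \prod_(k < d) (x _ + tau).
have [x0 x1] := x01 ord0 => PQ.
have P0 : 0 <= P by apply: prodr_ge0 => k _; have [] := x01 (lift ord0 k).
have Q0 : 0 <= Q by apply: prodr_ge0 => k _; have [? _] := x01 (lift ord0 k); rewrite addr_ge0.
have Q1 : Q <= 1 by apply: prodr_ile1 => k; have [? ?] := x01 (lift ord0 k); rewrite addr_ge0.
have dt : 0 <= d%:R * tau by rewrite mulr_ge0.
have h1 : x ord0 * Q <= x ord0 * (P + d%:R * tau) by rewrite ler_wpM2l.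
have h2 : tau * Q <= tau by rewrite ler_piMr.
have h3 : x ord0 * (d%:R * tau) <= d%:R * tau by rewrite ler_piMl //; lra.
rewrite mulrDl mulrDr in h1 *; rewrite mulrDl mul1r; lra.
Qed.

Lemma weight_positive (R : realType) (w : R -> R) :
  (forall x, 0 <= w x) -> 0 < mass w -> exists u, 0 < w u.
Proof.
move=> w0 tw; apply: contrapT => nw; move: tw.
rewrite /mass (@eq_Rintegral _ _ _ _ _ (cst 0)) ?Rintegral_cst ?mul0r ?ltxx //.
move=> x _ /=; apply/eqP; rewrite eq_le w0 andbT leNgt; apply/negP => wx.
by apply: nw; exists x.
Qed.

(** A nonzero continuous weight is bounded below near some point.  Nothing is
    known about the position of that point, which is why the boxes
    below are not centred at the points that they are meant to catch. *)
Lemma weights_bump (R : realType) (k : nat) (omega : 'I_k -> R -> R) :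
  weight_class 3 omega -> exists (u : 'I_k -> R) (kap eta : R),
    [/\ 0 < kap, 0 < eta & forall j x, `|x - u j| <= eta -> kap <= omega j x].
Proof.
move=> /weight_class_nice[K K0 W].
have [u uP] := choice (fun j => let: And3 n _ t := W j in
  weight_positive (fun x => nice_weight_ge0 x n) t).
have [v v0 vP] := positive_lower_bound uP.
exists u, (v / 2), (v / 2 / K); split; rewrite ?divr_gt0 // => j x.
have [[_ _ lip _] _ _] := W j; rewrite ler_pdivlMr // mulrC => h.
have := le_trans (lip x (u j)) h; rewrite ler_norml => /andP[? _].
by have := vP j; lra.
Qed.

Section clustering.
Variables (R : realType) (d : nat) (omega : 'I_d.+1 -> R -> R) (alpha : 'rV[R]_d).
Variables (u : 'I_d.+1 -> R) (kap eta : R).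
Hypothesis omega0 : forall j x, 0 <= omega j x.
Hypothesis kap0 : 0 < kap.
Hypothesis eta0 : 0 < eta.
Hypothesis bump : forall j x, `|x - u j| <= eta -> kap <= omega j x.
Variables (r n : nat) (t : 'I_d -> R) (s : 'I_d -> int).
Hypothesis n0 : (0 < n)%N.
Hypothesis t0 : forall k, 0 < t k.
Hypothesis ts : forall k, `|n%:R * alpha 0 k - (s k)%:~R| <= t k.

(** The number of cells per direction, the number of multiples of [n], and the
    ratio between the window and the span of these multiples. *)
Definition cells : nat := (Num.truncn (4 / eta)).+1.
Definition steps : nat := (r * cells ^ d).+1.
Definition stretch : nat := (Num.truncn (2 / eta)).+1.

(** The points are [m0 + j n], where [m0] moves them to the part of the window
    where the last weight is at least [kap].  In a direction whose natural radius
    [steps * t k / eta] is at most [1/4], all [j] stay within [eta] radii of each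
    other because [j n alpha] moves by at most [t k] at each step; in the capped
    directions this holds for the [j] in a common cell, of which there are more
    than [r]. *)
Lemma clustered_box :
  exists2 B : 'rV[R]_d * 'rV[R]_d, boxes R d B &
    (((r%:R * kap ^+ d.+1)%:E <= box_count omega alpha B (n * steps * stretch))%E /\
     box_vol B (n * steps * stretch) <=
       steps%:R ^+ d.+1 * stretch%:R / eta ^+ d * (n%:R * \prod_k t k)).
Proof.
pose N := (n * steps * stretch)%N.
have J0 : (0 : R) < steps%:R by rewrite ltr0n.
have Q0 : (0 : R) < cells%:R by rewrite ltr0n.
have NR0 : (0 : R) < N%:R by rewrite ltr0n /N !muln_gt0 n0.
have Q4 : cells%:R^-1 <= eta / 4.
  rewrite -[leRHS]invrK lef_pV2 ?posrE ?invr_gt0 ?divr_gt0 // invf_div.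
  exact/ltW/truncnS_gt.
have [|A [rA close]] := @cell_pigeonhole R 'I_steps 'I_d
    (fun j k => frac (j%:R * n%:R * alpha 0 k)) (fun=> cells) r
    (fun=> isT) (fun j k => frac_itv _).
  by rewrite prod_nat_const card_ord card_ord.
have [j0 j0A] : exists j, j \in A.
  by apply/card_gt0P; exact: leq_ltn_trans rA.
pose rho k : R := Num.min (steps%:R * t k / eta) 4^-1.
have rho_gt0 k : 0 < rho k.
  by rewrite lt_min divr_gt0 ?mulr_gt0 //= invr_gt0.
have rho_lt k : rho k < 2^-1.
  by apply: (@le_lt_trans _ _ 4^-1); [rewrite ge_min lexx orbT | lra].
pose m0 := Num.floor (u ord_max * N%:R).
pose last (j : 'I_steps) : int := m0 + (j * n)%:Z.
pose capped k := 4^-1 < steps%:R * t k / eta.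
pose cen k : R := (last j0)%:~R * alpha 0 k - rho k * u (widen_ord (leqnSn d) k).
pose B : 'rV[R]_d * 'rV[R]_d := (\row_k cen k, \row_k rho k).
(* The integers returning [j n alpha] next to [j0 n alpha]: from the integer
   parts in capped directions, from the approximation [s] in the others. *)
pose shift (j : 'I_steps) k : int :=
  if capped k then Num.floor (j0%:R * n%:R * alpha 0 k) - Num.floor (j%:R * n%:R * alpha 0 k)
  else (j0%:Z - j%:Z) * s k.
pose phi (j : 'I_steps) : 'rV[int]_d.+1 :=
  \row_l (if unlift ord_max l is Some k then shift j k else last j).
have phi_max j : phi j 0 ord_max = last j by rewrite mxE unlift_none.
have phi_widen j k : phi j 0 (widen_ord (leqnSn d) k) = shift j k.
  by rewrite mxE widen_lift liftK.
have phi_inj : injective phi.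
  move=> j j' /rowP/(_ ord_max); rewrite !phi_max => /addrI[] /eqP.
  by rewrite eqn_pmul2r // => /eqP/val_inj.
exists B.
  by move=> k; rewrite !mxE rho_gt0 rho_lt.
split; last first.
  rewrite /box_vol -/N.
  have -> : steps%:R ^+ d.+1 * stretch%:R / eta ^+ d * (n%:R * \prod_k t k) =
     (\prod_k (steps%:R * t k / eta)) * N%:R.
    rewrite !big_split /= prodfV !prodr_const card_ord /N !natrM exprS.
    by field; rewrite expf_neq0 // lt0r_neq0.
  rewrite ler_wpM2r // ; apply: ler_prod => k _; rewrite mxE ltW //= ge_min lexx //.
have weightP j k : j \in A -> kap <= omega (widen_ord (leqnSn d) k)
   (((phi j 0 (widen_ord (leqnSn d) k))%:~R + (phi j 0 ord_max)%:~R * alpha 0 k - B.1 0 k) / B.2 0 k).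
  move=> jA; apply: bump; rewrite phi_max phi_widen !mxE.
  set e := (shift j k)%:~R + ((last j)%:~R - (last j0)%:~R) * alpha 0 k.
  have -> : ((shift j k)%:~R + (last j)%:~R * alpha 0 k - cen k) / rho k -
     u (widen_ord (leqnSn d) k) = e / rho k.
    by rewrite /e /cen; field; exact: lt0r_neq0.
  have lastB : (last j)%:~R - (last j0)%:~R = (j%:R - j0%:R) * n%:R :> R.
    by rewrite /last !intrD !PoszM !intrM opprD addrACA subrr add0r -mulrBl.
  rewrite normrM normfV (gtr0_norm (rho_gt0 k)) ler_pdivrMr // /e lastB /shift.
  have [cap|ncap] := boolP (capped k).
    have -> : rho k = 4^-1 by apply/min_idPr/ltW.
    apply: le_trans (_ : _ <= cells%:R^-1) _; last by lra.
    have := ltW (close j j0 jA j0A k); congr (`|_| <= _).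
    by rewrite /frac intrB; ring.
  have -> : rho k = steps%:R * t k / eta by apply/min_idPl; rewrite leNgt.
  rewrite [leRHS]mulrC divfK ?lt0r_neq0 //.
  have -> : ((j0%:Z - j%:Z) * s k)%:~R + (j%:R - j0%:R) * n%:R * alpha 0 k =
     (j%:R - j0%:R) * (n%:R * alpha 0 k - (s k)%:~R) :> R.
    by rewrite intrM intrB; ring.
  rewrite normrM; apply: ler_pM => //.
  have := ltn_ord j; have := ltn_ord j0; rewrite -!(ltr_nat R) => ? ?.
  have := ler0n R j; have := ler0n R j0 => ? ?.
  by rewrite ler_norml; apply/andP; split; lra.
have lastP j : kap <= omega ord_max ((phi j 0 ord_max)%:~R / N%:R).
  apply: bump; rewrite phi_max.
  have -> : (last j)%:~R / N%:R - u ord_max =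
     ((m0%:~R - u ord_max * N%:R) + j%:R * n%:R) / N%:R.
    by rewrite /last intrD PoszM intrM; field; exact: lt0r_neq0.
  rewrite normrM normfV (gtr0_norm NR0) ler_pdivrMr //.
  have /andP[m1 m2] := floor_itv (u ord_max * N%:R); rewrite -/m0 intrD in m1 m2.
  pose S : R := steps%:R * n%:R.
  have S1 : 1 <= S by rewrite /S -natrM ler1n muln_gt0.
  have jS : j%:R * n%:R + n%:R <= S.
    by rewrite /S -natrM -natrD -mulSnr -natrM ler_nat leq_mul2r ltn_ord orbT.
  have n1 : 1 <= n%:R :> R by rewrite ler1n.
  have jn : 0 <= j%:R * n%:R :> R by rewrite mulr_ge0.
  have NE : eta * N%:R = S * (eta * stretch%:R) by rewrite /N /S !natrM; ring.
  have L2 : 2 <= eta * stretch%:R.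
    by rewrite mulrC -ler_pdivrMr //; exact/ltW/truncnS_gt.
  rewrite NE; apply: (@le_trans _ _ S); last by rewrite ler_peMr; lra.
  by rewrite ler_norml; apply/andP; split; lra.
pose g (a : 'rV[int]_d.+1) : R := omega ord_max ((a 0 ord_max)%:~R / N%:R) *
     \prod_(k < d) omega (widen_ord (leqnSn d) k)
       (((a 0 (widen_ord (leqnSn d) k))%:~R + (a 0 ord_max)%:~R * alpha 0 k
          - B.1 0 k) / B.2 0 k).
have g0 a : 0 <= g a by rewrite mulr_ge0 //; apply: prodr_ge0.
rewrite /box_count; apply: le_trans (esum_ge_finite phi_inj g0).
rewrite lee_fin; apply: (@le_trans _ _ (\sum_(j in A) g (phi j))); last first.
  by rewrite big_mkcond /=; apply: ler_sum => j _; case: ifP.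
apply: (@le_trans _ _ (\sum_(j in A) kap ^+ d.+1)).
  by rewrite sumr_const -[leRHS]mulr_natl ler_wpM2r ?exprn_ge0 ?(ltW kap0) // ler_nat ltnW.
apply: ler_sum => j jA; rewrite exprS; apply: ler_pM; rewrite ?exprn_ge0 ?(ltW kap0) //.
have -> : kap ^+ d = \prod_(k < d) kap by rewrite prodr_const card_ord.
by apply: ler_prod => k _; rewrite (ltW kap0) weightP.
Qed.

End clustering.

(** The parameter [r] is fixed first, from the size [A] to be exceeded; it
    determines the factor [D] between the volume of the box and the product
    [n t_1 ... t_d], and [n] is then chosen to make that volume at most [1]. *)
Lemma littlewood_implies_unbounded (R : realType) (d : nat) (omega : 'I_d.+1 -> R -> R) :
  weight_class 3 omega -> littlewood R d -> unbounded_smooth_discrepancy omega.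
Proof.
move=> W lw alpha; have [u [kap [eta [kap0 eta0 bump]]]] := weights_bump W.
have omega0 j x : 0 <= omega j x by have [] := W j.
have c0 : 0 <= weight_const omega.
  rewrite weight_constE; have [K K0 nW] := weight_class_nice W.
  have tot j : 0 <= mass (omega j) by apply: ltW; case: (nW j).
  by apply: mulr_ge0 => //; apply: prodr_ge0.
apply/eqyP => A A0; pose r := (Num.truncn ((A + weight_const omega) / kap ^+ d.+1)).+1.
have rA : A + weight_const omega <= r%:R * kap ^+ d.+1.
  by rewrite -ler_pdivrMr ?exprn_gt0 //; exact/ltW/truncnS_gt.
pose J := steps d eta r; pose L := stretch eta.
pose D : R := J%:R ^+ d.+1 * L%:R / eta ^+ d.
have D0 : 0 < D by rewrite divr_gt0 ?mulr_gt0 ?exprn_gt0 ?ltr0n.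
have un n : 0 <= n%:R * \prod_(k < d) dist_int (n%:R * alpha 0 k) :> R.
  by rewrite mulr_ge0 //; apply: prodr_ge0 => k _; exact: dist_int_ge0.
have iD0 : 0 < D^-1 by rewrite invr_gt0.
have [n n1 small] := (limn_einf_eq0P un).1 (lw alpha) D^-1 1%N iD0.
have nR0 : 0 < n%:R :> R by rewrite ltr0n.
set P := \prod_(k < d) _ in small.
have gap : 0 < D^-1 / n%:R - P by rewrite subr_gt0 ltr_pdivlMr // mulrC.
pose tau : R := Num.min 2^-1 ((D^-1 / n%:R - P) / d.+1%:R).
have tau0 : 0 < tau by rewrite lt_min divr_gt0 ?ltr0n // invr_gt0 ltr0n.
have dtau : d%:R * tau <= D^-1 / n%:R - P.
  apply: (@le_trans _ _ (d.+1%:R * tau)); first by rewrite ler_pM2r // ler_nat.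
  by rewrite mulrC -ler_pdivlMr ?ltr0n // ge_min lexx orbT.
pose t k := dist_int (n%:R * alpha 0 k) + tau.
have [s sP] := choice (fun k => dist_int_approx (n%:R * alpha 0 k) tau0).
have t0 k : 0 < t k by rewrite ltr_wpDl // dist_int_ge0.
have tP : n%:R * \prod_k t k <= D^-1.
  rewrite mulrC -ler_pdivlMr //; apply: le_trans (prod_perturb (ltW tau0) _) _.
    move=> k; split; first exact: dist_int_ge0.
    have := dist_int_le (n%:R * alpha 0 k) (nint (n%:R * alpha 0 k)).
    have := sdist_le (n%:R * alpha 0 k); rewrite /sdist.
    have : tau <= 2^-1 by rewrite ge_min lexx.
    lra.
  by rewrite -/P; lra.
have [B box [cB vB]] := clustered_box omega0 kap0 eta0 bump r n1 t0 sP.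
set N := (n * _ * _)%N in cB vB.
have N0 : (0 < N)%N by rewrite /N !muln_gt0 n1.
apply: (@le_trans _ _ (smooth_discrepancy omega alpha N)); last first.
  by apply: ereal_sup_ubound; exists N.
apply: (@le_trans _ _ `|box_discrepancy omega alpha B N|%E); last first.
  by apply: ereal_sup_ubound; exists B.
apply: le_trans (lee_abs _); rewrite /box_discrepancy.
apply: (@le_trans _ _ ((r%:R * kap ^+ d.+1)%:E - (weight_const omega * box_vol B N)%:E)%E).
  rewrite -EFinB lee_fin; have vol1 : box_vol B N <= 1.
    apply: le_trans vB _; rewrite -[leRHS](mulfV (lt0r_neq0 D0)).
    exact: (ler_wpM2l (ltW D0) tP).
  have : weight_const omega * box_vol B N <= weight_const omega by rewrite ler_piMr.
  lra.
by rewrite leeB.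
Qed.

Theorem theorem1p11 (R : realType) (d : nat) (hd : (2 <= d)%N)
    (omega : 'I_d.+1 -> R -> R) (homega : weight_class 3 omega) :
  littlewood R d <-> unbounded_smooth_discrepancy omega.
Proof.
split; first exact: littlewood_implies_unbounded.
exact: unbounded_implies_littlewood.
Qed.
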